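(* Let $\epsilon\in(0,1/2)$, let the input $x\in X$ be observed via $y^t=\bar A_tx+\xi^t$, $t=1,\dots,d$, and let the observation noise $\xi^d$ be Gaussian with zero mean and covariance matrix $\Theta\in\mathcal U_d$. Then for the quadratic change detection procedure described in the context: - if $x$ is a nuisance ($x\in N$), the probability for the procedure to terminate with a signal conclusion is at most $\epsilon$; - if $x$ is a signal of shape $k$ and magnitude $\ge\rho>0$ (that is, $x\in X\cap W_k^\rho$), and $t\le d$ is such that $\rho_{tk}\le\rho$, then the probability for the procedure to terminate with a signal conclusion at time $t$ or earlier is at least $1-\epsilon$.
   Context: **Notation.** $\mathbf S^m$, $\mathbf S^m_+$: symmetric, resp. positive semidefinite, $m\times m$ matrices; $\succeq$ is the semidefinite order; $\|\cdot\|$ is the spectral and $\|\cdot\|_F$ the Frobenius norm. $[a;b]$ is vertical, $[a,b]$ horizontal concatenation. $Z(x)=[x;1][x;1]^T\in\mathbf S^{n+1}_+$ for $x\in\mathbf R^n$. For a nonempty compact $\mathcal Z\subset\mathbf S^{n+1}$, $\phi_{\mathcal Z}(Y)=\max_{Z\in\mathcal Z}\mathrm{Tr}(ZY)$. **Observations.** $y^t=\bar A_tx+\xi^t=S_t[\bar A_dx+\xi^d]\in\mathbf R^{\nu_t}$, $t=1,\dots,d$, where $1\le\nu_1\le\dots\le\nu_d$, $\bar A_d$ is a given $\nu_d\times n$ matrix, $S_t$ is a given $\nu_t\times\nu_d$ matrix of rank $\nu_t$ ($S_d=I$), $S_{t-1}=R_tS_t$ for some matrix $R_t$, $\bar A_t=S_t\bar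 A_d$, $\xi^t=S_t\xi^d$. $\mathcal U$ is a given nonempty convex compact subset of $\mathrm{int}\,\mathbf S^{\nu_d}_+$, $\mathcal U_t=\{S_t\Theta S_t^T:\Theta\in\mathcal U\}$ (so $\mathcal U_d=\mathcal U$). **Inputs.** $Q_i\in\mathbf S^{n+1}$, $q_i\in\mathbf R$, $1\le i\le I_+$, $I<I_+$, are given; $Q_1=\mathrm{Diag}\{1,\dots,1,0\}$, $q_1=R^2$. Admissible inputs: $X=\{x:\mathrm{Tr}(Q_iZ(x))\le q_i,\ 1\le i\le I\}\ni0$; nuisances: $N=\{x:\mathrm{Tr}(Q_iZ(x))\le q_i,\ 1\le i\le I_+\}\ni0$. Put $\mathcal X=\{W\in\mathbf S^{n+1}_+:W_{n+1,n+1}=1,\mathrm{Tr}(WQ_i)\le q_i,1\le i\le I\}$ and $\mathcal N=\{W\in\mathbf S^{n+1}_+:W_{n+1,n+1}=1,\mathrm{Tr}(WQ_i)\le q_i,1\le i\le I_+\}$. For $k=1,\dots,K$, signals of shape $k$ and magnitude $\ge1$ form $W_k=\{x:\mathrm{Tr}(Q_{ik}Z(x))\le b_{ik},1\le i\le I_k\}$ with $Q_{ik}\in\mathbf S^{n+1}$, all $b_{ik}\le0$, at least one $b_{ik}<0$, where the index set $\{1,\dots,I_k\}$ is the union of $\mathcal I^A_k$ (type A: the north-west $n\times n$ block and the south-east diagonal entry of $Q_{ik}$ vanish) and $\mathcal I_k^B$ (type B: the only nonzeros of $Q_{ik}$ are in the north-west $n\times n$ block). For $\rho>0$, signals of shape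 $k$ and magnitude $\ge\rho$ are vectors from $W_k^\rho=\rho W_k$, and $$\mathcal W_k^\rho=\{W\in\mathbf S^{n+1}_+:W_{n+1,n+1}=1,\ \mathrm{Tr}(Q_{ik}W)\le\rho b_{ik},i\in\mathcal I_k^A,\ \mathrm{Tr}(Q_{ik}W)\le\rho^2b_{ik},i\in\mathcal I_k^B\}.$$ Let $\mathcal Z_k^\rho=\mathcal W_k^\rho\cap\mathcal X$. It is assumed that $\mathcal Z_k^\rho\ne\emptyset$ for small $\rho>0$; $R_k\in(0,\infty)$ is such that $\mathcal Z_k^\rho\neq\emptyset$ for $0<\rho\le R_k$ and $\mathcal Z_k^\rho=\emptyset$ for $\rho>R_k$. **Detectors.** $A_t=[\bar A_t,0]$, $B_t=[A_t;[0,\dots,0,1]]$. Fix $\gamma\in(0,1)$ and $\Theta_{*,d}\in\mathbf S^{\nu_d}_+$ with $\Theta_{*,d}\succeq\Theta$ for all $\Theta\in\mathcal U_d$; $\Theta_{*,t}=S_t\Theta_{*,d}S_t^T$. Let $\delta_t\in[0,2]$ satisfy $\|\Theta^{1/2}\Theta_{*,t}^{-1/2}-I\|\le\delta_t$ for all $\Theta\in\mathcal U_t$. Let $\mathcal H_t=\{(h,H)\in\mathbf R^{\nu_t}\times\mathbf S^{\nu_t}:-\gamma\Theta_{*,t}^{-1}\preceq H\preceq\gamma\Theta_{*,t}^{-1}\}$. For $\mathcal Z=\mathcal N$ or $\mathcal Z=\mathcal Z_k^\rho$, define on $\mathcal H_t\times\mathcal U_t$ $$\begin{aligned}F_{t,\mathcal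 Z}(h,H;\Theta)=&-\tfrac12\ln\det(I-\Theta_{*,t}^{1/2}H\Theta_{*,t}^{1/2})+\tfrac12\mathrm{Tr}([\Theta-\Theta_{*,t}]H)+\tfrac{\delta_t(2+\delta_t)}{2(1-\|\Theta_{*,t}^{1/2}H\Theta_{*,t}^{1/2}\|)}\|\Theta_{*,t}^{1/2}H\Theta_{*,t}^{1/2}\|_F^2\\&+\tfrac12\phi_{\mathcal Z}\!\left(B_t^T\left[\begin{bmatrix}H & h \\ h^T & 0\end{bmatrix}+[H,h]^T[\Theta_{*,t}^{-1}-H]^{-1}[H,h]\right]B_t\right),\end{aligned}$$ $\Phi_t=F_{t,\mathcal N}$, $\Phi_{tk\rho}=F_{t,\mathcal Z_k^\rho}$ ($0<\rho\le R_k$), and $$\mathcal{SV}_{tk}(\rho)=\min_{(h,H)\in\mathcal H_t}\max_{\Theta_1,\Theta_2\in\mathcal U_t}\tfrac12\left[\Phi_t(-h,-H;\Theta_1)+\Phi_{tk\rho}(h,H;\Theta_2)\right].$$ A saddle point $(h_*,H_*;\Theta_1^*,\Theta_2^* )$ exists and gives the quadratic detector $\phi_{tk\rho}(\omega)=\frac12\omega^TH_*\omega+h_*^T\omega+a$, $a=\frac12[\Phi_t(-h_*,-H_*;\Theta_1^* )-\Phi_{tk\rho}(h_*,H_*;\Theta_2^* )]$. The function $\mathcal{SV}_{tk}$ is nonpositive, nonincreasing and continuous on $(0,R_k]$ and tends to $0$ as $\rho\to+0$. **Procedure.** Set $\varkappa=\epsilon/\sqrt{dK}$, $\alpha=-\frac12\ln(dK)$.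 If $\mathcal{SV}_{tk}(R_k)>\ln\varkappa$, set $\rho_{tk}=+\infty$; otherwise let $\rho_{tk}\in(0,R_k]$ be such that $\mathcal{SV}_{tk}(\rho_{tk})=\ln\varkappa$. At step $t=1,\dots,d$, given $y^t$: if $\phi_{tk\rho_{tk}}(y^t)<\alpha$ for some $k\le K$ with $\rho_{tk}<\infty$, terminate with a signal conclusion; otherwise pass to $t+1$ (if $t<d$) or terminate without a signal conclusion (if $t=d$). *)

(* Defs.v *)
From HB Require Import structures.
From mathcomp Require Import all_boot all_order all_algebra.
From mathcomp Require Import all_classical all_reals all_analysis.

Set Implicit Arguments.
Unset Strict Implicit.
Unset Printing Implicit Defensive.

Import Order.TTheory GRing.Theory Num.Theory.
Import numFieldNormedType.Exports.

Local Open Scope classical_set_scope.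
Local Open Scope ring_scope.

Definition symmx (R : realType) (m : nat) : set 'M[R]_m := [set A | A^T = A].

Definition psdmx (R : realType) (m : nat) : set 'M[R]_m :=
  [set A | symmx A /\ forall v : 'cV[R]_m, 0 <= (v^T *m A *m v) 0 0].

(* [lemx A B] is the semidefinite order: B - A is positive semidefinite. *)
Definition lemx (R : realType) (m : nat) (A B : 'M[R]_m) : Prop := psdmx (B - A).

(* The interior of the semidefinite cone, relative to the space of symmetric
   matrices (its interior in the space of all matrices is empty for m > 1). *)
Definition psd_interior (R : realType) (m : nat) : set 'M[R]_m :=
  [set A | symmx A /\ \forall B \near A, symmx B -> psdmx B].

(* The positive semidefinite square root; 0 if A is not positive
   semidefinite. *)
Definition sqrtmx (R : realType) (m : nat) (A : 'M[R]_m) : 'M[R]_m :=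
  xget 0 [set B | psdmx B /\ B *m B = A].

(* Frobenius norm; on column vectors this is the Euclidean norm. *)
Definition frobnorm (R : realType) (m p : nat) (A : 'M[R]_(m, p)) : R :=
  Num.sqrt (\sum_i \sum_j A i j ^+ 2).

(* Spectral norm: the operator norm induced by the Euclidean norm. *)
Definition specnorm (R : realType) (m p : nat) (A : 'M[R]_(m, p)) : R :=
  sup [set frobnorm (A *m v) | v in [set v : 'cV[R]_p | frobnorm v <= 1]].

Definition support_fun (R : realType) (m : nat) (Z : set 'M[R]_m)
    (Y : 'M[R]_m) : R :=
  sup [set \tr (W *m Y) | W in Z].

Definition Zmx (R : realType) (n : nat) (x : 'cV[R]_n) : 'M[R]_(n + 1) :=
  col_mx x 1%:M *m (col_mx x 1%:M)^T.

(* Mutual independence; taking some of the sets equal to [setT] gives the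
   product rule for every subfamily. *)
Definition independent_RVs (R : realType) (dsp : measure_display)
    (Om : measurableType dsp) (P : probability Om R) (p : nat)
    (eta : 'I_p -> {RV P >-> R}) : Prop :=
  forall A : 'I_p -> set R, (forall j, measurable (A j)) ->
    P (\bigcap_j (eta j @^-1` A j)) = (\prod_(j < p) P (eta j @^-1` A j))%E.

(* xi is Gaussian with zero mean and covariance matrix Theta: xi = A eta with
   A A^T = Theta and eta a vector of independent standard normal variables. *)
Definition centered_gaussian (R : realType) (dsp : measure_display)
    (Om : measurableType dsp) (P : probability Om R) (m : nat)
    (xi : Om -> 'cV[R]_m) (Theta : 'M[R]_m) : Prop :=
  exists (p : nat) (A : 'M[R]_(m, p)) (eta : 'I_p -> {RV P >-> R}),
    [/\ A *m A^T = Theta,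
        independent_RVs eta,
        forall (j : 'I_p) (B : set R), measurable B ->
          distribution P (eta j) B = normal_prob 0 1 B
      & forall w, xi w = A *m (\col_j eta j w)].

(* Times t and the indices i of the constraints on the inputs are natural
   numbers starting from 1 (the values of nat-indexed fields outside
   1 <= t <= horizon and 1 <= i <= cplus are irrelevant); shapes k and the
   indices of the constraints of a given shape are ordinals. *)
Record model (R : realType) := Model {
  dimx : nat;                                           (* n *)
  horizon : nat;                                        (* d *)
  nu : nat -> nat;                                      (* nu_t *)
  Abar_d : 'M[R]_(nu horizon, dimx);
  Smx : forall t, 'M[R]_(nu t, nu horizon);             (* S_t *)
  Ucov : set 'M[R]_(nu horizon);                        (* U = U_d *)
  cadm : nat;                                           (* I *)
  cplus : nat;                                          (* I_+ *)
  Qin : nat -> 'M[R]_(dimx + 1);                        (* Q_i *)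
  qin : nat -> R;                                       (* q_i *)
  radius : R;                                           (* R *)
  nshapes : nat;                                        (* K *)
  nsig : 'I_nshapes -> nat;                             (* I_k *)
  typeA : forall k, {set 'I_(nsig k)};
  typeB : forall k, {set 'I_(nsig k)};
  Qsig : forall k, 'I_(nsig k) -> 'M[R]_(dimx + 1);     (* Q_ik *)
  bsig : forall k, 'I_(nsig k) -> R;                    (* b_ik *)
  rmax : 'I_nshapes -> R;                               (* R_k *)
  gamma : R;
  Thstar_d : 'M[R]_(nu horizon);                        (* Theta_{*,d} *)
  delta : nat -> R                                      (* delta_t *)
}.

Arguments Ucov {R} m.

Definition Abar (R : realType) (M : model R) (t : nat) :
    'M[R]_(nu M t, dimx M) :=
  Smx M t *m Abar_d M.

Definition Ucov_t (R : realType) (M : model R) (t : nat) : set 'M[R]_(nu M t) :=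
  [set Smx M t *m Theta *m (Smx M t)^T | Theta in Ucov M].
Arguments Ucov_t {R} M t.

Definition Thstar (R : realType) (M : model R) (t : nat) : 'M[R]_(nu M t) :=
  Smx M t *m Thstar_d M *m (Smx M t)^T.

Definition inputs (R : realType) (M : model R) (m : nat) : set 'cV[R]_(dimx M) :=
  [set x | forall i, (1 <= i <= m)%N -> \tr (Qin M i *m Zmx x) <= qin M i].
Arguments inputs {R} M m.

Definition admissible (R : realType) (M : model R) := inputs M (cadm M).
Definition nuisance (R : realType) (M : model R) := inputs M (cplus M).
Arguments admissible {R} M.
Arguments nuisance {R} M.

Definition lifted (R : realType) (M : model R) : set 'M[R]_(dimx M + 1) :=
  [set W | psdmx W /\ drsubmx W = 1%:M].
Arguments lifted {R} M.

Definition lifted_inputs (R : realType) (M : model R) (m : nat) :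
    set 'M[R]_(dimx M + 1) :=
  lifted M `&`
  [set W | forall i, (1 <= i <= m)%N -> \tr (W *m Qin M i) <= qin M i].
Arguments lifted_inputs {R} M m.

Definition calX (R : realType) (M : model R) := lifted_inputs M (cadm M).
Definition calN (R : realType) (M : model R) := lifted_inputs M (cplus M).
Arguments calX {R} M.
Arguments calN {R} M.

Definition signal1 (R : realType) (M : model R) (k : 'I_(nshapes M)) :
    set 'cV[R]_(dimx M) :=
  [set x | forall i, \tr (Qsig (k := k) i *m Zmx x) <= bsig i].

Definition signal (R : realType) (M : model R) (k : 'I_(nshapes M)) (r : R) :
    set 'cV[R]_(dimx M) :=
  [set r *: x | x in signal1 k].

Definition calW (R : realType) (M : model R) (k : 'I_(nshapes M)) (r : R) :
    set 'M[R]_(dimx M + 1) :=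
  lifted M `&`
  [set W |
    (forall i, i \in typeA k -> \tr (Qsig i *m W) <= r * bsig i) /\
    (forall i, i \in typeB k -> \tr (Qsig i *m W) <= r ^+ 2 * bsig i)].

Definition calZ (R : realType) (M : model R) (k : 'I_(nshapes M)) (r : R) :
    set 'M[R]_(dimx M + 1) :=
  calW k r `&` calX M.

Record model_ok (R : realType) (M : model R) : Prop := ModelOk {
  horizon_gt0 : (1 <= horizon M)%N;
  nshapes_gt0 : (1 <= nshapes M)%N;
  nu_gt0 : forall t, (1 <= t <= horizon M)%N -> (1 <= nu M t)%N;
  nu_mono : forall t, (1 < t <= horizon M)%N -> (nu M t.-1 <= nu M t)%N;
  Smx_rank : forall t, (1 <= t <= horizon M)%N -> \rank (Smx M t) = nu M t;
  Smx_horizon : Smx M (horizon M) = 1%:M;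
  Smx_prev : forall t, (1 < t <= horizon M)%N ->
    exists Rt : 'M[R]_(nu M t.-1, nu M t), Smx M t.-1 = Rt *m Smx M t;
  Ucov_neq0 : Ucov M !=set0;
  Ucov_convex : convex_set (M := 'M[R]_(nu M (horizon M))) (Ucov M);
  Ucov_compact : compact (Ucov M);
  Ucov_interior : Ucov M `<=` @psd_interior R (nu M (horizon M));
  cadm_gt0 : (1 <= cadm M)%N;
  cadm_lt : (cadm M < cplus M)%N;
  Qin_sym : forall i, (1 <= i <= cplus M)%N -> symmx (Qin M i);
  Qin1 : Qin M 1%N = block_mx 1%:M 0 0 0;
  qin1 : qin M 1%N = radius M ^+ 2;
  admissible0 : admissible M 0;
  nuisance0 : nuisance M 0;
  Qsig_sym : forall (k : 'I_(nshapes M)) i, symmx (Qsig (k := k) i);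
  bsig_le0 : forall (k : 'I_(nshapes M)) i, bsig (k := k) i <= 0;
  bsig_lt0 : forall k : 'I_(nshapes M), exists i, bsig (k := k) i < 0;
  type_cover : forall k : 'I_(nshapes M), typeA k :|: typeB k = [set: _]%SET;
  typeA_blocks : forall (k : 'I_(nshapes M)) i, i \in typeA k ->
    ulsubmx (Qsig i) = 0 /\ drsubmx (Qsig i) = 0;
  typeB_blocks : forall (k : 'I_(nshapes M)) i, i \in typeB k ->
    [/\ ursubmx (Qsig i) = 0, dlsubmx (Qsig i) = 0 & drsubmx (Qsig i) = 0];
  rmax_gt0 : forall k, 0 < rmax (m := M) k;
  calZ_neq0 : forall (k : 'I_(nshapes M)) r,
    0 < r <= rmax k -> calZ k r !=set0;
  calZ_eq0 : forall (k : 'I_(nshapes M)) r, rmax k < r -> calZ k r = set0;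
  gamma_in : 0 < gamma M < 1;
  Thstar_psd : psdmx (Thstar_d M);
  Thstar_ge : forall Theta, Ucov M Theta -> lemx Theta (Thstar_d M);
  delta_in : forall t, (1 <= t <= horizon M)%N -> 0 <= delta M t <= 2;
  delta_ge : forall t, (1 <= t <= horizon M)%N -> forall Theta, Ucov_t M t Theta ->
    specnorm (sqrtmx Theta *m invmx (sqrtmx (Thstar M t)) - 1%:M) <= delta M t
}.

Definition Amx (R : realType) (M : model R) (t : nat) :
    'M[R]_(nu M t, dimx M + 1) :=
  row_mx (Abar M t) 0.

Definition Bmx (R : realType) (M : model R) (t : nat) :
    'M[R]_(nu M t + 1, dimx M + 1) :=
  col_mx (Amx M t) (row_mx 0 1%:M).

Definition calH (R : realType) (M : model R) (t : nat) :
    set ('cV[R]_(nu M t) * 'M[R]_(nu M t)) :=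
  [set z | [/\ symmx z.2,
               lemx (- (gamma M *: invmx (Thstar M t))) z.2
             & lemx z.2 (gamma M *: invmx (Thstar M t))]].
Arguments calH {R} M t.

Definition Ffun (R : realType) (M : model R) (t : nat)
    (Z : set 'M[R]_(dimx M + 1)) (h : 'cV[R]_(nu M t)) (H : 'M[R]_(nu M t))
    (Theta : 'M[R]_(nu M t)) : R :=
  let T := Thstar M t in
  let G := sqrtmx T *m H *m sqrtmx T in
  - 2^-1 * ln (\det (1%:M - G))
  + 2^-1 * \tr ((Theta - T) *m H)
  + delta M t * (2 + delta M t) / (2 * (1 - specnorm G)) * frobnorm G ^+ 2
  + 2^-1 * support_fun Z
      ((Bmx M t)^T
       *m (block_mx H h h^T 0
           + (row_mx H h)^T *m invmx (invmx T - H) *m row_mx H h)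
       *m Bmx M t).

(* The cost [Phi_t(-h,-H;Theta1) + Phi_{tk rho}(h,H;Theta2)] / 2 of the
   saddle point problem. *)
Definition cost (R : realType) (M : model R) (t : nat) (k : 'I_(nshapes M))
    (r : R) (h : 'cV[R]_(nu M t)) (H Theta1 Theta2 : 'M[R]_(nu M t)) : R :=
  2^-1 * (Ffun (calN M) (- h) (- H) Theta1 + Ffun (calZ k r) h H Theta2).

Definition SV (R : realType) (M : model R) (t : nat) (k : 'I_(nshapes M))
    (r : R) : R :=
  inf [set sup [set cost k r z.1 z.2 Th.1 Th.2 | Th in Ucov_t M t `*` Ucov_t M t]
      | z in calH M t].

Record saddle (R : realType) (M : model R) (t : nat) := Saddle {
  sp_h : 'cV[R]_(nu M t);
  sp_H : 'M[R]_(nu M t);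
  sp_Th1 : 'M[R]_(nu M t);
  sp_Th2 : 'M[R]_(nu M t)
}.

Definition is_saddle (R : realType) (M : model R) (t : nat)
    (k : 'I_(nshapes M)) (r : R) (s : saddle M t) : Prop :=
  [/\ calH M t (sp_h s, sp_H s),
      Ucov_t M t (sp_Th1 s), Ucov_t M t (sp_Th2 s),
      forall h H, calH M t (h, H) ->
        cost k r (sp_h s) (sp_H s) (sp_Th1 s) (sp_Th2 s)
        <= cost k r h H (sp_Th1 s) (sp_Th2 s)
    & forall Theta1 Theta2, Ucov_t M t Theta1 -> Ucov_t M t Theta2 ->
        cost k r (sp_h s) (sp_H s) Theta1 Theta2
        <= cost k r (sp_h s) (sp_H s) (sp_Th1 s) (sp_Th2 s)].

Definition detector (R : realType) (M : model R) (t : nat)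
    (k : 'I_(nshapes M)) (r : R) (s : saddle M t) (omega : 'cV[R]_(nu M t)) : R :=
  let a := 2^-1 * (Ffun (calN M) (- sp_h s) (- sp_H s) (sp_Th1 s)
                   - Ffun (calZ k r) (sp_h s) (sp_H s) (sp_Th2 s)) in
  2^-1 * (omega^T *m sp_H s *m omega) 0 0 + ((sp_h s)^T *m omega) 0 0 + a.

Definition varkappa (R : realType) (M : model R) (eps : R) : R :=
  eps / Num.sqrt (horizon M * nshapes M)%:R.

Definition alpha (R : realType) (M : model R) : R :=
  - (2^-1 * ln (horizon M * nshapes M)%:R).

Definition magnitudes_ok (R : realType) (M : model R) (eps : R)
    (rho : nat -> 'I_(nshapes M) -> \bar R) : Prop :=
  forall t k, (1 <= t <= horizon M)%N ->
    (ln (varkappa M eps) < SV t k (rmax k) -> rho t k = +oo%E) /\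
    (SV t k (rmax k) <= ln (varkappa M eps) ->
      exists r : R, [/\ rho t k = r%:E, 0 < r <= rmax k
                      & SV t k r = ln (varkappa M eps)]).

Definition saddles_ok (R : realType) (M : model R)
    (rho : nat -> 'I_(nshapes M) -> \bar R)
    (sp : forall t, 'I_(nshapes M) -> saddle M t) : Prop :=
  forall t k, (1 <= t <= horizon M)%N -> (rho t k < +oo)%E ->
    is_saddle k (fine (rho t k)) (sp t k).

Definition alarm (R : realType) (M : model R)
    (rho : nat -> 'I_(nshapes M) -> \bar R)
    (sp : forall t, 'I_(nshapes M) -> saddle M t)
    (y : forall t, 'cV[R]_(nu M t)) (t : nat) : Prop :=
  exists k, (rho t k < +oo)%E /\
    detector k (fine (rho t k)) (sp t k) (y t) < alpha M.

(* [Some t] if the procedure run on the observations y terminates at step t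
   with a signal conclusion, [None] if it terminates without one. *)
Definition procedure (R : realType) (M : model R)
    (rho : nat -> 'I_(nshapes M) -> \bar R)
    (sp : forall t, 'I_(nshapes M) -> saddle M t)
    (y : forall t, 'cV[R]_(nu M t)) : option nat :=
  ohead [seq t <- iota 1 (horizon M) | `[< alarm rho sp y t >] ].

(* The observations y^t when the input is x and the noise at time d is xi. *)
Definition observations (R : realType) (M : model R) (x : 'cV[R]_(dimx M))
    (xi : 'cV[R]_(nu M (horizon M))) (t : nat) : 'cV[R]_(nu M t) :=
  Abar M t *m x + Smx M t *m xi.

(* Main.v *)
(* For an observation y = Abar_t x + xi^t, the expectation of
   exp(y^T H y / 2 + h^T y) is at most exp(F_{t,Z}(h,H;Theta)) as soon as Z(x) is in Z.
   Indeed this expectation is an explicit Gaussian integral: a power of a determinant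
   times the exponential of a quadratic form. The quadratic form is monotone in the
   covariance, which may thus be replaced by Theta_{*,t}, and is then dominated by the
   support function of Z; the determinant is controlled by the gradient inequality for
   the convex function X |-> - ln det(I - X) - Tr X.
   Applied at a saddle point, with (-h,-H) for a nuisance and with (h,H) for a signal,
   this bounds both E exp(-phi) and E exp(phi) by exp(SV_{tk}(rho_{tk})) = varkappa.
   With D = d K, the Markov inequality bounds a false alarm of one detector by
   exp(alpha) varkappa = epsilon / D, so that a union bound over the D detectors gives
   epsilon, and a missed signal by exp(-alpha) varkappa = epsilon. *)

Require Import Defs.
From HB Require Import structures.
From mathcomp Require Import all_boot all_order all_algebra complex.
From mathcomp Require Import all_classical all_reals all_analysis.
From mathcomp Require Import measurable_realfun.
From mathcomp Require Import ring lra.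

Set Implicit Arguments.
Unset Strict Implicit.
Unset Printing Implicit Defensive.

Import Order.TTheory GRing.Theory Num.Theory.
Import numFieldNormedType.Exports.

Local Open Scope classical_set_scope.
Local Open Scope ring_scope.

(** * Inner products and operator norms *)

(** The Frobenius inner product. On columns it is the Euclidean one, so vectors and matrices share
    the same rules and quadratic forms are scalars. *)
Definition mxdot (R : realType) (m n : nat) (A B : 'M[R]_(m, n)) : R :=
  \tr (A^T *m B).

Section Mxdot.
Context (R : realType) (m n : nat).
Implicit Types (A B C : 'M[R]_(m, n)) (a : R).

Lemma mxdotE A B : mxdot A B = \sum_i \sum_j A i j * B i j.
Proof.
rewrite /mxdot /mxtrace exchange_big /=; apply: eq_bigr => j _.
by rewrite mxE; apply: eq_bigr => i _; rewrite mxE.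
Qed.

Lemma mxdotC A B : mxdot A B = mxdot B A.
Proof. by rewrite /mxdot -mxtrace_tr trmx_mul trmxK. Qed.

Lemma mxdotDr A B C : mxdot A (B + C) = mxdot A B + mxdot A C.
Proof. by rewrite /mxdot mulmxDr mxtraceD. Qed.

Lemma mxdotDl A B C : mxdot (A + B) C = mxdot A C + mxdot B C.
Proof. by rewrite !(mxdotC _ C) mxdotDr. Qed.

Lemma mxdotZr a A B : mxdot A (a *: B) = a * mxdot A B.
Proof. by rewrite /mxdot -scalemxAr mxtraceZ. Qed.

Lemma mxdotZl a A B : mxdot (a *: A) B = a * mxdot A B.
Proof. by rewrite !(mxdotC _ B) mxdotZr. Qed.

Lemma mxdotNr A B : mxdot A (- B) = - mxdot A B.
Proof. by rewrite -scaleN1r mxdotZr mulN1r. Qed.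

Lemma mxdotNl A B : mxdot (- A) B = - mxdot A B.
Proof. by rewrite !(mxdotC _ B) mxdotNr. Qed.

Lemma mxdotBr A B C : mxdot A (B - C) = mxdot A B - mxdot A C.
Proof. by rewrite mxdotDr mxdotNr. Qed.

Lemma mxdotBl A B C : mxdot (A - B) C = mxdot A C - mxdot B C.
Proof. by rewrite mxdotDl mxdotNl. Qed.

Lemma mxdot0r A : mxdot A 0 = 0.
Proof. by rewrite /mxdot mulmx0 mxtrace0. Qed.

Lemma mxdot0l A : mxdot 0 A = 0.
Proof. by rewrite mxdotC mxdot0r. Qed.

Lemma mxdot_ge0 A : 0 <= mxdot A A.
Proof.
by rewrite mxdotE; apply: sumr_ge0 => i _; apply: sumr_ge0 => j _; rewrite -expr2 sqr_ge0.
Qed.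

Lemma mxdot_eq0 A : (mxdot A A == 0) = (A == 0).
Proof.
apply/eqP/eqP => [|->]; last exact: mxdot0r.
rewrite mxdotE => /eqP; rewrite psumr_eq0 => [/allP A0|i _]; last first.
  by apply: sumr_ge0 => j _; rewrite -expr2 sqr_ge0.
apply/matrixP => i j; move: (A0 i (mem_index_enum _)).
rewrite /= psumr_eq0 => [/allP/(_ j (mem_index_enum _))|k _] /=.
  by rewrite mulf_eq0 orbb mxE => /eqP.
by rewrite -expr2 sqr_ge0.
Qed.

Lemma mxdot_gt0 A : (0 < mxdot A A) = (A != 0).
Proof. by rewrite lt_def mxdot_eq0 mxdot_ge0 andbT. Qed.

(** The residual of the projection of B on A has a nonnegative square, and multiplying this by
    [mxdot A A] gives the inequality. *)
Lemma mxdot_CauchySchwarz A B : mxdot A B ^+ 2 <= mxdot A A * mxdot B B.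
Proof.
have [->|A0] := eqVneq A 0; first by rewrite !mxdot0l expr0n mul0r.
have := mxdot_ge0 (B - (mxdot A B / mxdot A A) *: A).
rewrite mxdotBl !mxdotBr !mxdotZr !mxdotZl (mxdotC B A) => H.
have Ap : 0 < mxdot A A by rewrite mxdot_gt0.
rewrite -subr_ge0 (_ : _ - _ = mxdot A A * (mxdot B B - mxdot A B / mxdot A A * mxdot A B -
   (mxdot A B / mxdot A A * mxdot A B -
      mxdot A B / mxdot A A * (mxdot A B / mxdot A A * mxdot A A)))).
  by rewrite mulr_ge0 // ltW.
by field; rewrite gt_eqF.
Qed.

Lemma frobnormE A : frobnorm A = Num.sqrt (mxdot A A).
Proof. by rewrite /frobnorm mxdotE. Qed.

Lemma frobnorm_ge0 A : 0 <= frobnorm A.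
Proof. exact: sqrtr_ge0. Qed.

Lemma sqr_frobnorm A : frobnorm A ^+ 2 = mxdot A A.
Proof. by rewrite frobnormE sqr_sqrtr // mxdot_ge0. Qed.

Lemma frobnorm_eq0 A : (frobnorm A == 0) = (A == 0).
Proof. by rewrite -sqrf_eq0 sqr_frobnorm mxdot_eq0. Qed.

Lemma frobnorm_le A (c : R) : 0 <= c -> mxdot A A <= c ^+ 2 -> frobnorm A <= c.
Proof.
by move=> c0 h; rewrite -(@ler_pXn2r _ 2) ?nnegrE ?frobnorm_ge0 // sqr_frobnorm.
Qed.

Lemma mxdot_le A B : mxdot A B <= frobnorm A * frobnorm B.
Proof.
rewrite (le_trans (ler_norm _)) // -(@ler_pXn2r _ 2) ?nnegrE ?mulr_ge0 ?frobnorm_ge0 //.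
by rewrite real_normK ?num_real // exprMn !sqr_frobnorm mxdot_CauchySchwarz.
Qed.

Lemma frobnormZ a A : frobnorm (a *: A) = `|a| * frobnorm A.
Proof.
rewrite !frobnormE mxdotZl mxdotZr mulrA -expr2 sqrtrM ?sqr_ge0 //.
by rewrite sqrtr_sqr.
Qed.

Lemma frobnormD A B : frobnorm (A + B) <= frobnorm A + frobnorm B.
Proof.
apply: frobnorm_le; first by rewrite addr_ge0 ?frobnorm_ge0.
rewrite mxdotDl !mxdotDr (mxdotC B A) sqrrD !sqr_frobnorm.
have := mxdot_le A B; lra.
Qed.

End Mxdot.

Lemma mxdot_mull (R : realType) (m n p : nat) (A : 'M[R]_(m, n))
    (M : 'M[R]_(m, p)) (B : 'M[R]_(p, n)) :
  mxdot A (M *m B) = mxdot (M^T *m A) B.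
Proof. by rewrite /mxdot trmx_mul trmxK mulmxA. Qed.

Lemma mxdot_trmx (R : realType) (m n : nat) (A B : 'M[R]_(m, n)) :
  mxdot A^T B^T = mxdot A B.
Proof. by rewrite /mxdot trmxK -mxtrace_tr trmx_mul trmxK mxtrace_mulC. Qed.

Lemma frobnorm_trmx (R : realType) (m n : nat) (A : 'M[R]_(m, n)) :
  frobnorm A^T = frobnorm A.
Proof. by rewrite !frobnormE mxdot_trmx. Qed.

Lemma mxdot_cV (R : realType) (n : nat) (u v : 'cV[R]_n) :
  mxdot u v = (u^T *m v) 0 0.
Proof. by rewrite /mxdot trace_mx11. Qed.

Lemma mxdot_col (R : realType) (m n : nat) (A B : 'M[R]_(m, n)) :
  mxdot A B = \sum_j mxdot (col j A) (col j B).
Proof.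
rewrite mxdotE exchange_big; apply: eq_bigr => j _; rewrite mxdotE.
by apply: eq_bigr => i _; rewrite big_ord1 !mxE.
Qed.

(** * Bounds on the operator norm *)

(** An upper bound on the spectral norm, free of the supremum. The sign condition matters for n = 0,
    where the inequality holds for every c. *)
Definition opbound (R : realType) (m n : nat) (A : 'M[R]_(m, n)) (c : R) :=
  0 <= c /\ forall v : 'cV[R]_n, frobnorm (A *m v) <= c * frobnorm v.

(** A acts on B column by column, and squared Frobenius norms add over columns. *)
Lemma frobnorm_mull (R : realType) (m n p : nat) (A : 'M[R]_(m, n)) (c : R)
  (B : 'M[R]_(n, p)) : opbound A c -> frobnorm (A *m B) <= c * frobnorm B.
Proof.
move=> [c0 Ac]; apply: frobnorm_le; first by rewrite mulr_ge0 ?frobnorm_ge0.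
rewrite exprMn sqr_frobnorm !mxdot_col mulr_sumr; apply: ler_sum => j _.
rewrite -!sqr_frobnorm -exprMn colE -mulmxA -colE.
by rewrite ler_pXn2r ?nnegrE ?mulr_ge0 ?frobnorm_ge0.
Qed.

Lemma opbound_frobnorm (R : realType) (m n : nat) (A : 'M[R]_(m, n)) :
  opbound A (frobnorm A).
Proof.
split=> [|v]; first exact: frobnorm_ge0.
apply: frobnorm_le; first by rewrite mulr_ge0 ?frobnorm_ge0.
rewrite exprMn !sqr_frobnorm -(mxdot_trmx A) !mxdot_col mulr_suml.
rewrite big_ord1 {1}/mxdot trace_mx11 mxE; apply: ler_sum => i _.
rewrite !mxE -expr2 (_ : \sum_j _ = mxdot (col i A^T) v); last first.
  by rewrite mxdotE; apply: eq_bigr => j _; rewrite big_ord1 !mxE.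
rewrite big_ord1 (_ : col 0 v = v) ?mxdot_CauchySchwarz //.
by apply/matrixP => a b; rewrite !mxE ord1.
Qed.

(** The Frobenius norm of A bounds the set, so the supremum in [specnorm] is a genuine one and not a
    default value. *)
Lemma specnorm_sup (R : realType) (m n : nat) (A : 'M[R]_(m, n)) :
  has_sup [set frobnorm (A *m v) | v in [set v : 'cV[R]_n | frobnorm v <= 1]].
Proof.
split.
  exists (frobnorm (A *m (0 : 'cV[R]_n))); exists 0 => //=.
  by rewrite frobnormE mxdot0r sqrtr0.
exists (frobnorm A) => _ [v /= v1 <-].
apply: le_trans (proj2 (opbound_frobnorm A) v) _.
by rewrite ler_piMr ?frobnorm_ge0.
Qed.

Lemma specnorm_ge0 (R : realType) (m n : nat) (A : 'M[R]_(m, n)) :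
  0 <= specnorm A.
Proof.
apply: (@le_trans _ _ (frobnorm (A *m (0 : 'cV[R]_n)))); first exact: frobnorm_ge0.
apply: sup_upper_bound; first exact: specnorm_sup.
by exists 0 => //=; rewrite frobnormE mxdot0r sqrtr0.
Qed.

Lemma opbound_specnorm (R : realType) (m n : nat) (A : 'M[R]_(m, n)) :
  opbound A (specnorm A).
Proof.
split=> [|v]; first exact: specnorm_ge0.
have [->|v0] := eqVneq v 0.
  by rewrite mulmx0 !frobnormE !mxdot0r sqrtr0 mulr0.
have vp : 0 < frobnorm v by rewrite lt_def frobnorm_eq0 v0 frobnorm_ge0.
have : frobnorm (A *m ((frobnorm v)^-1 *: v)) <= specnorm A.
  apply: sup_upper_bound; first exact: specnorm_sup.
  exists ((frobnorm v)^-1 *: v) => //=.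
  by rewrite frobnormZ gtr0_norm ?invr_gt0 // mulVf // gt_eqF.
by rewrite -scalemxAr frobnormZ gtr0_norm ?invr_gt0 // ler_pdivrMl // mulrC.
Qed.

Lemma specnorm_le (R : realType) (m n : nat) (A : 'M[R]_(m, n)) (c : R) :
  opbound A c -> specnorm A <= c.
Proof.
move=> [c0 Ac]; apply: ge_sup.
  by have [] := specnorm_sup A.
move=> _ [v /= v1 <-]; apply: le_trans (Ac v) _.
by rewrite ler_piMr.
Qed.

(** The square of |A^T v| is the inner product of A A^T v with v, hence at most c |A^T v| |v|;
    divide by |A^T v|. *)
Lemma opbound_trmx (R : realType) (m n : nat) (A : 'M[R]_(m, n)) (c : R) :
  opbound A c -> opbound A^T c.
Proof.
move=> [c0 Ac]; split=> // v.
have [E|E] := eqVneq (frobnorm (A^T *m v)) 0.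
  by rewrite E mulr_ge0 ?frobnorm_ge0.
have Ep : 0 < frobnorm (A^T *m v) by rewrite lt_def E frobnorm_ge0.
rewrite -(ler_pM2r Ep) -expr2 sqr_frobnorm mxdot_mull trmxK.
rewrite (le_trans (mxdot_le _ _)) //.
rewrite (le_trans (ler_wpM2r (frobnorm_ge0 _) (Ac _))) //.
by rewrite mulrAC.
Qed.

Lemma opboundM (R : realType) (m n p : nat) (A : 'M[R]_(m, n))
    (B : 'M[R]_(n, p)) (a b : R) :
  opbound A a -> opbound B b -> opbound (A *m B) (a * b).
Proof.
move=> [a0 Aa] [b0 Bb]; split=> [|v]; first exact: mulr_ge0.
by rewrite -mulmxA (le_trans (Aa _)) // -mulrA ler_wpM2l.
Qed.

Lemma frobnorm_mulr (R : realType) (m n p : nat) (A : 'M[R]_(m, n)) (c : R)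
  (B : 'M[R]_(p, m)) : opbound A c -> frobnorm (B *m A) <= c * frobnorm B.
Proof.
move=> /opbound_trmx Ac; rewrite -frobnorm_trmx trmx_mul -(frobnorm_trmx B).
exact: frobnorm_mull.
Qed.

(* Polarization, applied to v and a multiple of A v of the same norm. *)
Lemma opbound_sym (R : realType) (n : nat) (A : 'M[R]_n) (c : R) :
  0 <= c -> A^T = A -> (forall v : 'cV[R]_n, `|mxdot v (A *m v)| <= c * mxdot v v) ->
  opbound A c.
Proof.
move=> c0 As Ac; split=> // v; set w := A *m v.
have [E|E] := eqVneq (frobnorm w) 0; first by rewrite E mulr_ge0 ?frobnorm_ge0.
have wp : 0 < frobnorm w by rewrite lt_def E frobnorm_ge0.
pose u := (frobnorm v / frobnorm w) *: w.
have uu : mxdot u u = mxdot v v.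
  rewrite mxdotZl mxdotZr -!sqr_frobnorm; field; exact: E.
have uv : mxdot u (A *m v) = frobnorm v * frobnorm w.
  rewrite -/w mxdotZl -sqr_frobnorm; field; exact: E.
have vu : mxdot v (A *m u) = frobnorm v * frobnorm w.
  by rewrite mxdot_mull As mxdotC.
have := Ac (u + v); have := Ac (u - v).
rewrite !mulmxBr !mulmxDr !mxdotBl !mxdotDl !mxdotBr !mxdotDr uu uv vu (mxdotC v u).
rewrite -sqr_frobnorm !ler_norml => /andP[h1 _] /andP[_ h2].
have [v0|v0] := eqVneq (frobnorm v) 0.
  by move: E; rewrite /w; move/eqP: v0; rewrite frobnorm_eq0 => /eqP->;
     rewrite mulmx0 frobnormE mxdot0r sqrtr0 eqxx.
have vp : 0 < frobnorm v by rewrite lt_def v0 frobnorm_ge0.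
rewrite -(ler_pM2l vp); lra.
Qed.

(** * Positive definite matrices *)

Definition posdef (R : realType) (n : nat) (A : 'M[R]_n) : Prop :=
  A^T = A /\ forall v : 'cV[R]_n, v != 0 -> 0 < mxdot v (A *m v).

Lemma psdmxP (R : realType) (n : nat) (A : 'M[R]_n) :
  psdmx A <-> A^T = A /\ forall v : 'cV[R]_n, 0 <= mxdot v (A *m v).
Proof.
by split=> -[As Ap]; split=> // v; have := Ap v; rewrite mxdot_cV mulmxA.
Qed.

Lemma lemxP (R : realType) (n : nat) (A B : 'M[R]_n) (v : 'cV[R]_n) :
  lemx A B -> mxdot v (A *m v) <= mxdot v (B *m v).
Proof.
by move=> /psdmxP[_ /(_ v)]; rewrite mulmxBl mxdotBr subr_ge0.
Qed.

Lemma sym_blockE (R : realType) (n : nat) (A : 'M[R]_(1 + n)) : A^T = A ->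
  A = block_mx (A 0 0)%:M (dlsubmx A)^T (dlsubmx A) (drsubmx A).
Proof.
move=> As; rewrite -[LHS]submxK; congr block_mx; last by rewrite -{1}As -trmx_dlsub.
apply/matrixP => i j; rewrite !mxE !ord1 eqxx mulr1n.
by congr (A _ _); apply/val_inj.
Qed.

(* With [w] the minimizer of the first coordinate, A (w, v) = (0, S v) where
   S is the Schur complement. *)
Lemma posdef_block (R : realType) (n : nat) (a : R) (c : 'cV[R]_n) (B : 'M[R]_n) :
  posdef (block_mx a%:M c^T c B) -> 0 < a /\ posdef (B - a^-1 *: (c *m c^T)).
Proof.
move=> [As Ap].
have a0 : 0 < a.
  have /Ap : col_mx 1%:M 0 != 0 :> 'cV[R]_(1 + n).
    by rewrite col_mx_eq0 negb_and -[1%:M]/(1 : 'M[R]_1) oner_eq0.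
  rewrite mul_block_col !mulmx0 !addr0 !mulmx1 /mxdot tr_col_mx mul_row_col.
  by rewrite trmx0 mul0mx addr0 trmx1 mul1mx mxtrace_scalar mulr1n.
split=> //; split.
  move: As; rewrite tr_block_mx => E; have [_ _ _ Bs] := eq_block_mx E.
  by rewrite linearB linearZ /= trmx_mul trmxK Bs.
move=> v v0; pose w := - a^-1 *: (c^T *m v).
have /Ap : col_mx w v != 0 by rewrite col_mx_eq0 negb_and v0 orbT.
rewrite mul_block_col /mxdot tr_col_mx mul_row_col.
have -> : a%:M *m w + c^T *m v = 0.
  by rewrite mul_scalar_mx scalerA mulrN divff ?gt_eqF // scaleN1r addNr.
have -> : c *m w + B *m v = (B - a^-1 *: (c *m c^T)) *m v.
  by rewrite mulmxBl [LHS]addrC /w -scalemxAr scaleNr -scalemxAl mulmxA.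
by rewrite mulmx0 add0r.
Qed.

(** Left multiplication by a unit lower triangular matrix clears c and leaves the Schur
    complement. *)
Lemma det_block (R : realType) (n : nat) (a : R) (c : 'cV[R]_n) (B : 'M[R]_n) :
  a != 0 ->
  \det (block_mx a%:M c^T c B) = a * \det (B - a^-1 *: (c *m c^T)).
Proof.
move=> a0; have := det_mulmx (block_mx 1%:M 0 (- a^-1 *: c) 1%:M) (block_mx a%:M c^T c B).
rewrite det_lblock !det1 !mul1r => <-; rewrite mulmx_block !mul1mx !mul0mx !addr0.
have -> : - a^-1 *: c *m a%:M + c = 0.
  by rewrite mul_mx_scalar scalerA mulrN divff // scaleN1r addNr.
by rewrite det_ublock det_scalar1 addrC -scalemxAl scaleNr.
Qed.

(** Induction on the dimension: the determinant is a times that of the Schur complement, whose trace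
    is at most the trace of B, and a <= exp (a - 1). *)
Lemma posdef_det (R : realType) (n : nat) (A : 'M[R]_n) :
  posdef A -> 0 < \det A <= expR (\tr A - n%:R).
Proof.
elim: n A => [A _|n IH A Ap].
  by rewrite det_mx00 /mxtrace big_ord0 subrr expR0 ltr01 lexx.
have Aeq := @sym_blockE R n A Ap.1; move: Ap; rewrite Aeq.
move: (A 0 0) (dlsubmx _) (drsubmx _) => a c B.
move=> /[dup] Ap /posdef_block[a0 /IH/andP[d0 d1]].
rewrite det_block ?gt_eqF //; apply/andP; split; first exact: mulr_gt0.
rewrite (@mxtrace_block _ 1 n) mxtrace_scalar mulr1n -[n.+1]addn1 natrD.
have -> : a + \tr B - (n%:R + 1) = (a - 1) + (\tr B - n%:R) by ring.
rewrite expRD; apply: ler_pM; [exact: ltW|exact: ltW| |].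
  by have := expR_ge1Dx (a - 1); rewrite addrC subrK.
rewrite (le_trans d1) // ler_expR lerB // linearB linearZ /= mxtrace_mulC.
by rewrite gerBl mulr_ge0 ?invr_ge0 ?(ltW a0) //; exact: mxdot_ge0.
Qed.

Lemma posdef_unit (R : realType) (n : nat) (A : 'M[R]_n) :
  posdef A -> A \in unitmx.
Proof. by move=> /posdef_det/andP[d _]; rewrite unitmxE unitfE gt_eqF. Qed.

Lemma posdef_inv (R : realType) (n : nat) (A : 'M[R]_n) :
  posdef A -> posdef (invmx A).
Proof.
move=> /[dup] /posdef_unit Au [As Ap]; split; first by rewrite trmx_inv As.
move=> v v0; have := Ap (invmx A *m v); rewrite mulKVmx // mxdotC => -> //.
by apply: contraNneq v0 => /(congr1 (mulmx A)); rewrite mulKVmx // mulmx0 => ->.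
Qed.

Lemma posdef_psd (R : realType) (n : nat) (A : 'M[R]_n) :
  posdef A -> psdmx A.
Proof.
move=> [As Ap]; apply/psdmxP; split=> // v.
by have [->|/Ap/ltW//] := eqVneq v 0; rewrite mxdot0l.
Qed.

Lemma posdef_congr (R : realType) (n : nat) (A L : 'M[R]_n) :
  posdef A -> L \in unitmx -> posdef (L^T *m A *m L).
Proof.
move=> [As Ap] Lu; split; first by rewrite !trmx_mul trmxK As mulmxA.
move=> v v0; rewrite -!mulmxA mxdot_mull trmxK Ap //.
by apply: contraNneq v0 => /(congr1 (mulmx (invmx L))); rewrite mulKmx // mulmx0 => ->.
Qed.

Lemma posdef_ge (R : realType) (n : nat) (A B : 'M[R]_n) :
  posdef A -> lemx A B -> posdef B.
Proof.
move=> [As Ap] AB; split=> [|v v0]; last exact: lt_le_trans (Ap v v0) (lemxP v AB).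
have /psdmxP[] := AB; rewrite linearB /= As => /(congr1 (+%R A)).
by rewrite addrC subrK addrC subrK.
Qed.

(** * Square roots of semidefinite matrices *)

(** It allows a function of the eigenvalues to be realized as a polynomial in the matrix. A new node
    is added with a multiple of the polynomial that vanishes at the old ones. *)
Lemma interpolation (F : fieldType) (g : F -> F) (s : seq F) :
  exists q : {poly F}, forall x, x \in s -> q.[x] = g x.
Proof.
elim: s => [|x s [q qs]]; first by exists 0.
have [xs|xs] := boolP (x \in s).
  by exists q => y; rewrite in_cons => /predU1P[->|]; apply: qs.
pose r : {poly F} := \prod_(y <- s) ('X - y%:P).
have rx : r.[x] != 0.
  by rewrite -[_ == _]/(root r x) root_prod_XsubC.
exists (q + ((g x - q.[x]) / r.[x])%:P * r) => y; rewrite !hornerE in_cons.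
move=> /predU1P[->|ys]; first by rewrite divfK // addrC subrK.
by rewrite (qs _ ys) (_ : r.[y] = 0) ?mulr0 ?addr0 //; apply/rootP; rewrite root_prod_XsubC.
Qed.

Lemma trmx_horner (F : fieldType) (n : nat) (A : 'M[F]_n.+1) (p : {poly F}) :
  A^T = A -> (horner_mx A p)^T = horner_mx A p.
Proof.
move=> As; elim/poly_ind: p => [|p c IH]; first by rewrite rmorph0 trmx0.
rewrite rmorphD rmorphM /= horner_mx_X horner_mx_C linearD /= trmx_mul As IH tr_scalar_mx.
by congr (_ + _); rewrite -[RHS]comm_mx_horner.
Qed.

(** The spectral theorem for Hermitian matrices, applied to the complexification of A. The basis P
    is complex, but the spectrum is real and consists of eigenvalues of A over R. *)
Lemma sym_diagonalizable (R : realType) (n : nat) (A : 'M[R]_n.+1) : A^T = A ->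
  exists (P : 'M[R[i]]_n.+1) (e : 'rV[R]_n.+1),
    [/\ P \in unitmx,
        map_mx (real_complex R) A =
          invmx P *m diag_mx (map_mx (real_complex R) e) *m P
      & forall j, eigenvalue A (e 0 j)].
Proof.
move=> As; set AC := map_mx _ A.
have ACh : AC \is hermsymmx.
  apply: realsym_hermsym.
    by apply/is_hermitianmxP; rewrite expr0 scale1r map_mx_id // map_trmx As.
  by apply/mxOverP => i j; rewrite mxE; apply/complex_realP; exists (A i j).
have /orthomx_spectralP := hermitian_normalmx ACh.
have /mxOverP := hermitian_spectral_diag_real ACh.
have := spectral_unit AC.
move: (spectralmx AC) (spectral_diag AC) => P d Pu dr ACE.
pose e := map_mx (@complex.Re R) d.
have dE : d = map_mx (real_complex R) e.
  by apply/matrixP => i j; rewrite !mxE RRe_real.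
exists P, e; split; rewrite -?dE // => j.
rewrite -(eigenvalue_map (real_complex R)); apply/eigenvalueP.
(* The rows of P are left eigenvectors, nonzero since P is invertible. *)
exists (row j P).
  rewrite -row_mul -/AC ACE mulmxA mulKVmx // row_mul row_diag_mx -scalemxAl -rowE.
  by rewrite dE mxE.
apply/eqP => P0; have : delta_mx 0 j *m P = 0 :> 'rV[R[i]]_n.+1 by rewrite -rowE.
move/(congr1 (mulmx^~ (invmx P))); rewrite mulmxK // mul0mx.
by move=> /matrixP/(_ 0 j)/eqP; rewrite !mxE !eqxx oner_eq0.
Qed.

(* The fourth root of A is a polynomial in A, hence symmetric; its square is
   then a positive semidefinite square root. *)
Lemma psd_sqrt_exists (R : realType) (n : nat) (A : 'M[R]_n) :
  psdmx A -> exists B, psdmx B /\ B *m B = A.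
Proof.
case: n A => [|n] A /psdmxP[As Ap].
  exists 0; split; last by rewrite [RHS]flatmx0 mul0mx.
  apply/psdmxP; split=> [|v]; first exact: trmx0.
  by rewrite mul0mx mxdot0r.
have [P [e [Pu AE eA]]] := sym_diagonalizable As.
have e0 j : 0 <= e 0 j.
  have /eigenvalueP[v vA v0] := eA j.
  have := Ap v^T; rewrite (_ : A *m v^T = e 0 j *: v^T); last first.
    by rewrite -{1}As -trmx_mul vA linearZ.
  by rewrite mxdotZr mxdot_trmx pmulr_lge0 // mxdot_gt0.
have [q qe] := interpolation (fun x : R => Num.sqrt (Num.sqrt x)) [seq e 0 j | j <- enum 'I_n.+1].
have Ss := trmx_horner q As; set S := horner_mx A q in Ss.
exists (S *m S); split.
  apply/psdmxP; split=> [|v]; first by rewrite trmx_mul Ss.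
  by rewrite -mulmxA mxdot_mull Ss mxdot_ge0.
have -> : S *m S *m (S *m S) = horner_mx A (q * q * (q * q)) by rewrite !rmorphM.
(* The equality of real matrices is checked over the complex numbers, where A is diagonal in the
   basis P and q acts on each eigenvalue. *)
apply: (map_mx_inj (f := real_complex R)).
rewrite map_horner_mx AE -[X in _ *m X]invmxK horner_mx_uconj ?invmxK; last first.
  by rewrite -[_ \is a _]/(_ \in unitmx) unitmx_inv.
congr (_ *m _ *m _); rewrite horner_mx_diag; congr diag_mx.
apply/matrixP => i j; rewrite !mxE horner_map /= ord1; congr (_%:C)%C.
rewrite !hornerM qe; last by apply/mapP; exists j; rewrite ?mem_enum.
by rewrite -!expr2 !sqr_sqrtr ?sqrtr_ge0.
Qed.

Lemma sqrtmxP (R : realType) (n : nat) (A : 'M[R]_n) :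
  psdmx A -> psdmx (sqrtmx A) /\ sqrtmx A *m sqrtmx A = A.
Proof.
by move=> /psd_sqrt_exists Ap; have := xgetPex 0 Ap.
Qed.

Lemma sqrtmx_sym (R : realType) (n : nat) (A : 'M[R]_n) :
  psdmx A -> (sqrtmx A)^T = sqrtmx A.
Proof. by move=> /sqrtmxP[/psdmxP[]]. Qed.

Lemma sqrtmx_unit (R : realType) (n : nat) (A : 'M[R]_n) :
  posdef A -> sqrtmx A \in unitmx.
Proof.
move=> /[dup] /posdef_psd/sqrtmxP[_ E] /posdef_unit.
by rewrite -{1}E unitmx_mul => /andP[].
Qed.

(* The gradient inequality for the convex function - ln det. *)
Lemma ln_det_le (R : realType) (n : nat) (A B : 'M[R]_n) :
  posdef A -> posdef B ->
  ln (\det A) - ln (\det B) <= \tr (invmx B *m (A - B)).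
Proof.
move=> Ap Bp; have Bs := sqrtmx_sym (posdef_psd Bp).
have [_ BB] := sqrtmxP (posdef_psd Bp).
have Lu := sqrtmx_unit Bp; set L := sqrtmx B in Bs BB Lu.
have iLs : (invmx L)^T = invmx L by rewrite trmx_inv Bs.
(* Conjugation by the inverse square root of B reduces the claim to the case B = 1, which is the
   upper bound of [posdef_det]. *)
have Mp : posdef (invmx L *m A *m invmx L).
  by rewrite -{1}iLs; apply: posdef_congr; rewrite ?unitmx_inv.
have /andP[Ad _] := posdef_det Ap; have /andP[Bd _] := posdef_det Bp.
have /andP[_ Md] := posdef_det Mp.
have invB : invmx B = invmx L *m invmx L 
  by rewrite -[RHS](mulKmx (posdef_unit Bp)) -{3}BB -(mulmxA L) mulKVmx // mulmxV // mulmx1.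
have dM : \det (invmx L *m A *m invmx L) = \det A / \det B.
  by rewrite !det_mulmx mulrAC mulrC -det_mulmx -invB det_inv.
have tM : \tr (invmx L *m A *m invmx L) - n%:R = \tr (invmx B *m (A - B)).
  rewrite mulmxBr mulVmx ?(posdef_unit Bp) // linearB /= mxtrace1.
  by rewrite mxtrace_mulC mulmxA -invB.
rewrite -ln_div ?posrE // -tM -[leRHS]expRK ler_ln ?posrE ?expR_gt0 ?divr_gt0 //.
by rewrite -dM.
Qed.

(** * Determinants and quadratic forms under a change of covariance *)

(** Sylvester's identity, from two triangular factorizations of one block matrix. *)
Lemma det_1BmulC (R : comPzRingType) (m n : nat) (A : 'M[R]_(m, n)) (B : 'M[R]_(n, m)) :
  \det (1%:M - A *m B) = \det (1%:M - B *m A).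
Proof.
have E1 : block_mx 1%:M A B 1%:M = block_mx 1%:M 0 B 1%:M *m block_mx 1%:M A 0 (1%:M - B *m A).
  by rewrite mulmx_block !mul1mx !mulmx1 !mul0mx !addr0 addrC subrK.
have E2 : block_mx 1%:M A B 1%:M = block_mx 1%:M A 0 1%:M *m block_mx (1%:M - A *m B) 0 B 1%:M.
  by rewrite mulmx_block !mul1mx !mulmx1 !mul0mx !add0r subrK.
have := congr1 determinant E2; rewrite E1 !det_mulmx !det_lblock !det_ublock !det1.
by rewrite !mul1r mulr1 => ->.
Qed.

Lemma posdef_1B (R : realType) (n : nat) (A : 'M[R]_n) (c : R) :
  A^T = A -> opbound A c -> c < 1 -> posdef (1%:M - A).
Proof.
move=> As [_ Ac] c1; split=> [|v v0]; first by rewrite linearB /= trmx1 As.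
rewrite mulmxBl mul1mx mxdotBr subr_gt0 (le_lt_trans (mxdot_le _ _)) //.
have vp : 0 < frobnorm v by rewrite lt_def frobnorm_eq0 v0 frobnorm_ge0.
rewrite (le_lt_trans (ler_wpM2l (ltW vp) (Ac v))) // -sqr_frobnorm expr2 ltr_pM2l //.
by rewrite gtr_pMl.
Qed.

(** The image w of v satisfies w = v + A w, so |w| <= |v| + c |w|. *)
Lemma opbound_inv1B (R : realType) (n : nat) (A : 'M[R]_n) (c : R) :
  A^T = A -> opbound A c -> c < 1 -> opbound (invmx (1%:M - A)) (1 - c)^-1.
Proof.
move=> As Ac c1; have Au := posdef_unit (posdef_1B As Ac c1); case: Ac => _ Ac.
split=> [|v]; first by rewrite invr_ge0 subr_ge0 ltW.
set w := invmx _ *m v.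
have vE : w = v + A *m w.
  by apply/(canRL (subrK _)); rewrite -[X in X - _]mul1mx -mulmxBl mulKVmx.
rewrite ler_pdivlMl ?subr_gt0 //.
have := frobnormD v (A *m w); rewrite -vE; have := Ac w; lra.
Qed.

(** With L the square root of T and w = L^-1 v, the square of |A^T w| is the form of A A^T at w, at
    most that of T at w, which is the square of |v|. The factor A may be rectangular, to cover both
    the square root of a covariance and the matrix in [centered_gaussian]. *)
Lemma opbound_factor_quotient (R : realType) (m p : nat) (T : 'M[R]_m)
    (A : 'M[R]_(m, p)) :
  posdef T -> lemx (A *m A^T) T -> opbound (A^T *m invmx (sqrtmx T)) 1.
Proof.
move=> Tp TT; split=> // v; rewrite mul1r.
apply: frobnorm_le; first exact: frobnorm_ge0.
have [_ LL] := sqrtmxP (posdef_psd Tp).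
rewrite -mulmxA mxdot_mull trmxK mulmxA mxdotC.
apply: le_trans (lemxP _ TT) _.
move: LL (sqrtmx_sym (posdef_psd Tp)) (sqrtmx_unit Tp).
move: (sqrtmx T) => L LL Ls Lu.
by rewrite -LL -mulmxA mulKVmx // mxdot_mull Ls mulKVmx // sqr_frobnorm.
Qed.

(* [Y = V G V^T] with [V = Th^{1/2} T^{-1/2}], a contraction at distance at most d from
   the identity; the bound is the gradient inequality for the convex function
   X |-> - ln det (1 - X) - tr X between G and Y. *)
Lemma ln_det_perturb (R : realType) (n : nat) (T Th H : 'M[R]_n) (d : R)
    (G := sqrtmx T *m H *m sqrtmx T) :
  posdef T -> psdmx Th -> lemx Th T -> H^T = H -> specnorm G < 1 ->
  specnorm (sqrtmx Th *m invmx (sqrtmx T) - 1%:M) <= d ->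
  0 < \det (1%:M - H *m Th) /\
  - 2^-1 * ln (\det (1%:M - H *m Th)) <=
  - 2^-1 * ln (\det (1%:M - G)) + 2^-1 * \tr ((Th - T) *m H)
  + d * (2 + d) / (2 * (1 - specnorm G)) * frobnorm G ^+ 2.
Proof.
move=> Tp Thp TT Hs; set s := specnorm G => s1 Vd.
have [_ KK] := sqrtmxP Thp; have [_ LL] := sqrtmxP (posdef_psd Tp).
have Ks := sqrtmx_sym Thp; have Ls := sqrtmx_sym (posdef_psd Tp).
have V1 : opbound (sqrtmx Th *m invmx (sqrtmx T)) 1.
  by rewrite -{1}Ks; apply: opbound_factor_quotient; rewrite // Ks KK.
have Lu := sqrtmx_unit Tp.
have d0 : 0 <= d := le_trans (specnorm_ge0 _) Vd.
have Vd' : opbound (sqrtmx Th *m invmx (sqrtmx T) - 1%:M) d.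
  split=> // v; apply: le_trans (proj2 (opbound_specnorm _) v) _.
  by rewrite ler_wpM2r ?frobnorm_ge0.
move: V1 Vd'; set V := _ *m invmx _ => V1 Vd'.
pose Y := V *m G *m V^T.
have VT : V^T = invmx (sqrtmx T) *m sqrtmx Th by rewrite trmx_mul trmx_inv Ls Ks.
have YE : Y = sqrtmx Th *m H *m sqrtmx Th.
  by rewrite /Y /G VT !mulmxA mulmxKV // mulmxK.
have Gs : G^T = G by rewrite !trmx_mul Hs Ls mulmxA.
have Ys : Y^T = Y by rewrite YE !trmx_mul Hs Ks mulmxA.
have Gb : opbound G s := opbound_specnorm G.
have Yb : opbound Y s.
  by have := opboundM (opboundM V1 Gb) (opbound_trmx V1); rewrite mul1r mulr1.
have Gp := posdef_1B Gs Gb s1; have Yp := posdef_1B Ys Yb s1.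
have dY : \det (1%:M - Y) = \det (1%:M - H *m Th).
  by rewrite YE -mulmxA det_1BmulC -mulmxA KK.
rewrite -dY; split; first by have /andP[] := posdef_det Yp.
have := ln_det_le Gp Yp.
have -> : 1%:M - G - (1%:M - Y) = Y - G by rewrite opprB addrC addrA subrK.
have trE : \tr (Y - G) = \tr ((Th - T) *m H).
  rewrite YE /G mulmxBl !linearB /=; congr (_ - _).
    by rewrite mxtrace_mulC mulmxA KK.
  by rewrite mxtrace_mulC mulmxA LL.
(* By (1 - Y)^-1 = 1 + (1 - Y)^-1 Y, the gradient term splits into a trace, which is the linear term
   of the bound, and a remainder of second order. *)
have -> : \tr (invmx (1%:M - Y) *m (Y - G)) =
    \tr (Y - G) + mxdot (invmx (1%:M - Y) *m Y)^T (Y - G).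
  rewrite /mxdot trmxK -mxtraceD -[X in \tr (X + _)]mul1mx -mulmxDl; congr (\tr (_ *m _)).
  apply/esym; rewrite -[X in X + _](mulVmx (posdef_unit Yp)) -mulmxDr subrK mulmx1 //.
rewrite trE => gradient.
have frobY : frobnorm (invmx (1%:M - Y) *m Y)^T <= (1 - s)^-1 * frobnorm G.
  rewrite frobnorm_trmx (le_trans (frobnorm_mull _ (opbound_inv1B Ys Yb s1))) //.
  rewrite ler_wpM2l ?invr_ge0 ?subr_ge0 ?(ltW s1) //.
  apply: le_trans (frobnorm_mulr _ (opbound_trmx V1)) _; rewrite mul1r.
  by apply: le_trans (frobnorm_mull _ V1) _; rewrite mul1r.
have frobYG : frobnorm (Y - G) <= d * (2 + d) * frobnorm G.
  (* Each of the two terms has norm at most d |G|, since V is a contraction at distance at most d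
     from the identity. *)
  have -> : Y - G = (V - 1%:M) *m G *m V^T + G *m (V - 1%:M)^T.
    by rewrite linearB /= trmx1 !mulmxBl mulmxBr mul1mx mulmx1 addrA subrK.
  apply: le_trans (frobnormD _ _) _.
  have h1 := frobnorm_mulr ((V - 1%:M) *m G) (opbound_trmx V1).
  have h2 := frobnorm_mull G Vd'.
  have h3 := frobnorm_mulr G (opbound_trmx Vd').
  have : 0 <= d * d * frobnorm G by rewrite !mulr_ge0 ?frobnorm_ge0.
  lra.
have cross := mxdot_le (invmx (1%:M - Y) *m Y)^T (Y - G).
have : frobnorm (invmx (1%:M - Y) *m Y)^T * frobnorm (Y - G) <=
    (1 - s)^-1 * frobnorm G * (d * (2 + d) * frobnorm G).
  by apply: ler_pM; rewrite ?frobnorm_ge0.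
rewrite (_ : d * (2 + d) / _ * _ =
  2^-1 * ((1 - s)^-1 * frobnorm G * (d * (2 + d) * frobnorm G))); last first.
  by field; rewrite subr_eq0 gt_eqF.
lra.
Qed.

(** Evaluating the two semidefinite bounds at L v, with L the square root of T, turns c T^-1 into c
    times the identity; [opbound_sym] passes from the form to the norm. *)
Lemma opbound_scaled (R : realType) (m : nat) (T H : 'M[R]_m) (c : R) :
  posdef T -> 0 <= c -> H^T = H ->
  lemx (- (c *: invmx T)) H -> lemx H (c *: invmx T) ->
  opbound (sqrtmx T *m H *m sqrtmx T) c.
Proof.
move=> Tp c0 Hs Hl Hu.
move: (proj2 (sqrtmxP (posdef_psd Tp))) (sqrtmx_sym (posdef_psd Tp)) (sqrtmx_unit Tp).
move: (sqrtmx T) => L LL Ls Lu.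
apply: opbound_sym => // [|v]; first by rewrite !trmx_mul Ls Hs mulmxA.
have E : mxdot (L *m v) (invmx T *m (L *m v)) = mxdot v v.
  rewrite -{1}Ls -mxdot_mull (_ : L *m _ = v) //.
  have -> : L *m v = T *m (invmx L *m v) by rewrite -LL -mulmxA mulKVmx.
  by rewrite mulKmx ?posdef_unit // mulKVmx.
have := lemxP (L *m v) Hl; have := lemxP (L *m v) Hu.
rewrite mulNmx mxdotNr -scalemxAl mxdotZr E => h1 h2.
by rewrite -!mulmxA mxdot_mull Ls ler_norml h1 h2.
Qed.

(** Insert L^-1 L on both sides of H, with L the square root of T: the outer factors A^T L^-1 and
    its transpose are contractions. *)
Lemma opbound_congr (R : realType) (m p : nat) (T H : 'M[R]_m) (A : 'M[R]_(m, p))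
    (c : R) :
  posdef T -> lemx (A *m A^T) T -> opbound (sqrtmx T *m H *m sqrtmx T) c ->
  opbound (A^T *m H *m A) c.
Proof.
move=> Tp TT Hc; have Ls := sqrtmx_sym (posdef_psd Tp); have Lu := sqrtmx_unit Tp.
have A1 := opbound_factor_quotient Tp TT.
have := opboundM (opboundM A1 Hc) (opbound_trmx A1).
by rewrite mul1r mulr1 trmx_mul trmx_inv trmxK Ls !mulmxA mulmxKV // mulmxK.
Qed.

Lemma posdef_invB (R : realType) (m : nat) (T H : 'M[R]_m) (c : R) :
  posdef T -> H^T = H -> c < 1 -> lemx H (c *: invmx T) -> posdef (invmx T - H).
Proof.
move=> /posdef_inv[iTs iTp] Hs c1 Hu; split=> [|v v0]; first by rewrite linearB /= iTs Hs.
rewrite mulmxBl mxdotBr subr_gt0 (le_lt_trans (lemxP v Hu)) //.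
by rewrite -scalemxAl mxdotZr gtr_pMl // iTp.
Qed.

(* The maximum over v of [2 g.v - v^T M v], with [M = T^-1 - H], is [g^T M^-1 g];
   the choice v = A u gives the bound. *)
Lemma quad_form_le (R : realType) (m p : nat) (T H : 'M[R]_m) (A : 'M[R]_(m, p))
    (g : 'cV[R]_m) (u : 'cV[R]_p) :
  posdef T -> lemx (A *m A^T) T -> posdef (invmx T - H) ->
  u = A^T *m (g + H *m (A *m u)) ->
  mxdot g (A *m u) <= mxdot g (invmx (invmx T - H) *m g).
Proof.
move=> Tp TT Mp uE; set M := invmx T - H in Mp *.
set z := A *m u; set q := g + H *m z.
have zE : z = A *m A^T *m q by rewrite -mulmxA -uE.
have Mg := mulKVmx (posdef_unit Mp) g.
move: (invmx M *m g) Mg => w Mw.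
have h1 : 0 <= mxdot (w - z) (M *m (w - z)).
  by have /psdmxP[_] := posdef_psd Mp; apply.
rewrite mulmxBr Mw mxdotBl !mxdotBr mxdot_mull (proj1 Mp) Mw in h1.
have h2 : mxdot z (M *m z) = mxdot z (invmx T *m z) - mxdot z (q - g).
  by rewrite /q (addrC g) addrK -mxdotBr -mulmxBl.
pose y := invmx T *m z; rewrite -/y in h2.
have Ty : T *m y = z by rewrite mulKVmx // posdef_unit.
(* By [h1] and [h2] it remains to bound z.y by z.q. Expanding the form of A A^T at q - y, with A A^T
   q = z, and using A A^T <= T at y, with T y = z, gives this. *)
have h3 : 0 <= mxdot (q - y) (A *m A^T *m (q - y)).
  by rewrite -mulmxA mxdot_mull mxdot_ge0.
have h4 := lemxP y TT; clearbody y q z.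
have symAA : (A *m A^T)^T = A *m A^T by rewrite trmx_mul trmxK.
rewrite mulmxBr -zE mxdotBl !mxdotBr mxdot_mull symAA -zE in h3.
rewrite Ty in h4; rewrite mxdotBr in h2.
rewrite !(mxdotC _ z) in h1 h2 h3 h4 *; rewrite (mxdotC w) in h1; lra.
Qed.

(** * Gaussian integrals *)

(** The change of variables holds with the Radon-Nikodym derivative, which agrees almost everywhere
    with the density since both have the same integral over every measurable set. *)
Lemma integral_normal_prob (R : realType) (m s : R) (f : R -> \bar R) :
  measurable_fun setT f -> (forall z, 0 <= f z)%E ->
  (\int[normal_prob m s]_z f z =
   \int[lebesgue_measure]_z (f z * (normal_pdf m s z)%:E))%E.
Proof.
move=> mf f0; have dom := normal_prob_dominates m s.
rewrite -(Radon_Nikodym_SigmaFinite.change_of_variables dom) //.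
have mpdf : measurable_fun setT (fun z => (normal_pdf m s z)%:E).
  by apply/measurable_EFinP; exact: measurable_normal_pdf.
have mRN := measurable_int _ (Radon_Nikodym_SigmaFinite.f_integrable dom).
apply: ge0_ae_eq_integral => //.
- exact: emeasurable_funM.
- exact: emeasurable_funM.
- by move=> z _; rewrite mule_ge0 //; apply: Radon_Nikodym_SigmaFinite.f_ge0.
- by move=> z _; rewrite mule_ge0 // lee_fin normal_pdf_ge0.
apply: ae_eqe_mul2l; apply: integral_ae_eq => //.
  exact: Radon_Nikodym_SigmaFinite.f_integrable.
move=> E _ mE; rewrite -Radon_Nikodym_SigmaFinite.f_integral //.
Qed.

(* Completing the square: the integrand times the standard density is a
   multiple of the density with mean b / (1 - a) and variance 1 / (1 - a). *)
Lemma integral_normal_expR_quad (R : realType) (a b : R) : 0 < 1 - a ->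
  (\int[normal_prob 0 1]_z (expR (2^-1 * (a * z ^+ 2) + b * z))%:E =
   ((Num.sqrt (1 - a))^-1 * expR (2^-1 * ((1 - a)^-1 * b ^+ 2)))%:E)%E.
Proof.
move=> a1; set n := 1 - a.
have n0 : n != 0 by rewrite gt_eqF.
have sn0 : Num.sqrt n != 0 by rewrite gt_eqF // sqrtr_gt0.
rewrite integral_normal_prob; first last.
- by move=> z; rewrite lee_fin expR_ge0.
- apply/measurable_EFinP; apply: measurableT_comp => //.
  by apply: measurable_funD => //; do 2 apply: measurable_funM => //;
     apply: measurable_funX.
set c := _ * expR _.
transitivity (\int[lebesgue_measure]_z
    (c%:E * (normal_pdf (b / n) (Num.sqrt n)^-1 z)%:E))%E.
  apply: eq_integral => z _; rewrite -!EFinM; congr _%:E.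
  rewrite !normal_pdfE ?invr_eq0 ?oner_eq0 // /normal_fun /normal_peak.
  rewrite exprVn sqr_sqrtr ?(ltW a1) // expr1n mul1r.
  have -> : Num.sqrt (n^-1 * pi *+ 2) = (Num.sqrt n)^-1 * Num.sqrt (pi *+ 2).
    by rewrite -mulrnAr sqrtrM ?invr_ge0 ?(ltW a1) // sqrtrV // ltW.
  rewrite invfM invrK /c; set q := (Num.sqrt (pi *+ 2))^-1.
  have H x y : (Num.sqrt n)^-1 * x * (Num.sqrt n * q * y) = q * (x * y) by field.
  rewrite H -expRD mulrCA -expRD; congr (_ * expR _).
  have -> : a = 1 - n by rewrite /n opprB addrC subrK.
  by field.
rewrite integralZl //=; last exact: integrable_normal_pdf.
by rewrite integral_normal_pdf mule1.
Qed.

(** * Independence and product laws *)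

Definition boxes (R : realType) (p : nat) : set (set (p.-tuple R)) :=
  [set B | exists A : 'I_p -> set R, (forall i, measurable (A i)) /\
    B = [set t | forall i, A i (tnth t i)]].

Lemma measurable_boxes (R : realType) (p : nat) :
  @measurable _ (p.-tuple R) = <<s @boxes R p >>.
Proof.
apply/seteqP; split.
  apply: smallest_sub; first exact: smallest_sigma_algebra.
  rewrite -bigcup_seq => B [i _ [A mA <-]]; apply: sub_sigma_algebra.
  exists (fun j => if j == i then A else setT); split=> [j|]; first by case: ifP.
  apply/seteqP; split=> t /= tA; first by move=> j; case: eqP => // ->; case: tA.
  by split=> //; have := tA i; rewrite eqxx.
apply: smallest_sub; first exact: sigma_algebra_measurable.
move=> B [A [mA ->]].
have -> : [set t : p.-tuple R | forall i, A i (tnth t i)] =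
    \bigcap_i ((fun t : p.-tuple R => tnth t i) @^-1` A i).
  by apply/seteqP; split=> t /= h i; [move=> _; exact: h|exact: h].
apply: fin_bigcap_measurable => // i _.
by rewrite -[X in measurable X]setTI; apply: measurable_tnth.
Qed.

(** Boxes generate the sigma-algebra, are stable under intersection and include the whole space, so
    uniqueness of finite measures on a generating pi-system applies. *)
Lemma tuple_measure_unique (R : realType) (p : nat)
    (m1 m2 : {measure set (p.-tuple R) -> \bar R}) :
  (m1 setT < +oo)%E -> (forall B, @boxes R p B -> m1 B = m2 B) ->
  forall B, measurable B -> m1 B = m2 B.
Proof.
move=> fin m12; apply: (measure_unique (@boxes R p) (fun=> setT)) => //.
- exact: measurable_boxes.
- move=> _ _ [A [mA ->]] [B [mB ->]]; exists (fun i => A i `&` B i); split.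
    by move=> i; apply: measurableI.
  by apply/seteqP; split=> t /= => [[h1 h2] i|h]; [split|split=> i; have [] := h i].
- move=> _; exists (fun=> setT); split=> //; apply/seteqP; split=> t //=.
- by rewrite bigcup_const.
Qed.

(** A tuple rather than a column, to use the product sigma-algebra of [p.-tuple R]. *)
Definition RVtuple (d : measure_display) (Om : measurableType d) (R : realType)
    (P : probability Om R) (p : nat) (eta : 'I_p -> {RV P >-> R}) (w : Om) :
  p.-tuple R := [tuple eta i w | i < p].

Lemma measurable_RVtuple (d : measure_display) (Om : measurableType d) (R : realType)
    (P : probability Om R) (p : nat) (eta : 'I_p -> {RV P >-> R}) :
  measurable_fun setT (RVtuple eta).
Proof.
apply/measurable_fun_tnthP => i.
rewrite (_ : _ \o _ = eta i); first exact: measurable_funPT.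
by apply/funext => w /=; rewrite tnth_mktuple.
Qed.

HB.instance Definition _ (d : measure_display) (Om : measurableType d) (R : realType)
    (P : probability Om R) (p : nat) (eta : 'I_p -> {RV P >-> R}) :=
  isMeasurableFun.Build _ _ _ _ (RVtuple eta) (measurable_RVtuple eta).

Lemma independent_RVs_box (d : measure_display) (Om : measurableType d) (R : realType)
    (P : probability Om R) (p : nat) (eta : 'I_p.+1 -> {RV P >-> R})
    (A : set R) (B : 'I_p -> set R) :
  independent_RVs eta -> measurable A -> (forall i, measurable (B i)) ->
  P (eta ord0 @^-1` A `&`
     RVtuple (fun i => eta (lift ord0 i)) @^-1` [set t | forall i, B i (tnth t i)]) =
  (P (eta ord0 @^-1` A) * \prod_(i < p) P (eta (lift ord0 i) @^-1` B i))%E.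
Proof.
(* The family C puts A at the first index and B at the others, so that independence applies to it
   directly. *)
move=> indep mA mB; pose C j := if unlift ord0 j is Some i then B i else A.
have C0 : C ord0 = A by rewrite /C unlift_none.
have CS i : C (lift ord0 i) = B i by rewrite /C liftK.
have mC j : measurable (C j) by rewrite /C; case: unlift.
have := indep C mC; rewrite big_ord_recl C0.
under eq_bigr do rewrite CS.
move=> <-; congr (P _); apply/seteqP; split=> w /=.
  move=> [Aw Bw] j _; rewrite /= /C; case: unliftP => [i ->|-> //].
  by have := Bw i; rewrite tnth_mktuple.
move=> Cw; split=> [|i]; first by have := Cw ord0 I; rewrite /= C0.
by have := Cw (lift ord0 i) I; rewrite /= CS tnth_mktuple.
Qed.

Lemma RVtuple_box (d : measure_display) (Om : measurableType d) (R : realType)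
    (P : probability Om R) (p : nat) (eta : 'I_p.+1 -> {RV P >-> R})
    (B : 'I_p -> set R) :
  independent_RVs eta -> (forall i, measurable (B i)) ->
  P (RVtuple (fun i => eta (lift ord0 i)) @^-1` [set t | forall i, B i (tnth t i)]) =
  (\prod_(i < p) P (eta (lift ord0 i) @^-1` B i))%E.
Proof.
move=> indep mB; have := independent_RVs_box indep (@measurableT _ R) mB.
by rewrite preimage_setT setTI probability_setT mul1e.
Qed.

Lemma independent_RVs_tail (d : measure_display) (Om : measurableType d) (R : realType)
    (P : probability Om R) (p : nat) (eta : 'I_p.+1 -> {RV P >-> R}) :
  independent_RVs eta -> independent_RVs (fun i => eta (lift ord0 i)).
Proof.
move=> indep B mB; rewrite -(RVtuple_box indep mB); congr (P _).
apply/seteqP; split=> w /= Bw i; first by rewrite tnth_mktuple; apply: Bw.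
by move=> _; have := Bw i; rewrite tnth_mktuple.
Qed.

(** For fixed A both sides are finite measures in B: the image of P restricted to the event of A,
    and a multiple of the law of the tail. They agree on boxes, hence everywhere. *)
Lemma independent_RVs_head (d : measure_display) (Om : measurableType d) (R : realType)
    (P : probability Om R) (p : nat) (eta : 'I_p.+1 -> {RV P >-> R})
    (A : set R) (B : set (p.-tuple R)) :
  independent_RVs eta -> measurable A -> measurable B ->
  P (eta ord0 @^-1` A `&` RVtuple (fun i => eta (lift ord0 i)) @^-1` B) =
  (P (eta ord0 @^-1` A) * P (RVtuple (fun i => eta (lift ord0 i)) @^-1` B))%E.
Proof.
move=> indep mA mB; set T := RVtuple _.
have mEA : measurable (eta ord0 @^-1` A).
  by rewrite -[X in measurable X]setTI; apply: measurable_funPT.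
have PEA : P (eta ord0 @^-1` A) \is a fin_num by rewrite fin_num_measure.
have PEA0 : 0 <= fine (P (eta ord0 @^-1` A)) by rewrite fine_ge0.
pose m1 : {measure set (p.-tuple R) -> \bar R} := pushforward (mrestr P mEA) T.
pose m2 : {measure set (p.-tuple R) -> \bar R} :=
  mscale (NngNum PEA0) (distribution P T).
have m12 C : boxes C -> m1 (measurable_RVtuple _) C = m2 C.
  move=> [D [mD ->]]; rewrite /m1 /m2 /= /pushforward /mrestr /mscale /= fineK // setIC.
  by rewrite independent_RVs_box // -(RVtuple_box indep mD).
rewrite setIC.
have := @tuple_measure_unique R p (m1 (measurable_RVtuple _)) m2 _ m12 B mB.
rewrite /m1 /m2 /= /pushforward /mrestr /mscale /= fineK //; apply.
by rewrite preimage_setT setTI ltey_eq PEA.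
Qed.

(* The library puts [normal_prob] on [measurableTypeR R], whose display is not
   convertible to that of the canonical measurable structure of R. *)
Lemma expectation_independent_head (d : measure_display) (Om : measurableType d)
    (R : realType) (P : probability Om R) (p : nat) (eta : 'I_p.+1 -> {RV P >-> R})
    (nu : probability (measurableTypeR R) R)
    (f : measurableTypeR R * p.-tuple R -> \bar R)
    (T := RVtuple (fun i => eta (lift ord0 i))) :
  independent_RVs eta ->
  (forall B, measurable B -> distribution P (eta ord0) B = nu B) ->
  measurable_fun setT f -> (forall z, 0 <= f z)%E ->
  (\int[P]_w f (eta ord0 w : measurableTypeR R, T w) =
   \int[P]_w \int[nu]_z f (z, T w))%E.
Proof.
move=> indep lawE mf f0.
pose Y w : measurableTypeR R * p.-tuple R := (eta ord0 w : measurableTypeR R, T w).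
have mY : measurable_fun setT Y.
  apply: measurable_fun_pair; last exact: measurable_RVtuple.
  have m0 : measurable_fun setT (eta ord0) by exact: measurable_funPT.
  exact: m0.
pose X : {mfun Om >-> (measurableTypeR R * p.-tuple R)%type} :=
  HB.pack Y (isMeasurableFun.Build _ _ _ _ _ mY).
transitivity (\int[distribution P X]_z f z)%E.
  by rewrite ge0_integral_distribution.
(* The joint law is the product of [nu] and the law of the tail; Tonelli then integrates the first
   coordinate inside. *)
rewrite (@eq_measure_integral _ _ _ _ (nu \x distribution P T)%E); last first.
  move=> A mA _; apply/esym/product_measure_unique => // B C mB mC.
  rewrite /= /distribution /pushforward /= -lawE //.
  exact: independent_RVs_head.
rewrite fubini_tonelli2 // ge0_integral_distribution //.
  exact: measurable_fun_fubini_tonelli_G.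
by move=> t; apply: integral_ge0.
Qed.

(** * The Gaussian integral in several variables *)

Definition col_tuple (R : realType) (p : nat) (t : p.-tuple R) : 'cV[R]_p :=
  \col_j tnth t j.

Lemma col_RVtuple (d : measure_display) (Om : measurableType d) (R : realType)
    (P : probability Om R) (p : nat) (eta : 'I_p -> {RV P >-> R}) (w : Om) :
  col_tuple (RVtuple eta w) = \col_j eta j w.
Proof. by apply/matrixP => i j; rewrite !mxE tnth_mktuple. Qed.

Lemma measurable_mxdot_col_tuple (R : realType) (p : nat) (a : 'cV[R]_p) :
  measurable_fun setT (fun t : p.-tuple R => mxdot a (col_tuple t)).
Proof.
rewrite (_ : (fun t => _) = fun t => \sum_i a i 0 * tnth t i); last first.
  by apply/funext => t; rewrite mxdotE; apply: eq_bigr => i _; rewrite big_ord1 mxE.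
apply: measurable_sum => i; apply: measurable_funM => //.
exact: measurable_tnth.
Qed.

Lemma measurable_quad_col_tuple (R : realType) (p : nat) (G : 'M[R]_p) :
  measurable_fun setT (fun t : p.-tuple R => mxdot (col_tuple t) (G *m col_tuple t)).
Proof.
rewrite (_ : (fun t => _) =
    fun t => \sum_i tnth t i * mxdot (row i G)^T (col_tuple t)); last first.
  apply/funext => t; rewrite mxdotE; apply: eq_bigr => i _; rewrite big_ord1.
  by congr (_ * _); [rewrite mxE|rewrite mxdot_cV trmxK -row_mul [RHS]mxE].
apply: measurable_sum => i; apply: measurable_funM; first exact: measurable_tnth.
exact: measurable_mxdot_col_tuple.
Qed.

Lemma measurable_quad_RV (d : measure_display) (Om : measurableType d) (R : realType)
    (P : probability Om R) (p : nat) (eta : 'I_p -> {RV P >-> R})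
    (s : R) (G : 'M[R]_p) (b : 'cV[R]_p) :
  measurable_fun setT (fun w => let X := \col_j eta j w in
    s * mxdot X (G *m X) + mxdot b X).
Proof.
under eq_fun do rewrite /= -col_RVtuple.
apply: measurable_funD.
  apply: measurable_funM => //.
  exact: measurableT_comp (@measurable_quad_col_tuple R p G) (measurable_RVtuple eta).
exact: measurableT_comp (measurable_mxdot_col_tuple b) (measurable_RVtuple eta).
Qed.

Lemma mxdot_col_mx (R : realType) (m n p : nat) (A1 B1 : 'M[R]_(m, p)) (A2 B2 : 'M[R]_(n, p)) :
  mxdot (col_mx A1 A2) (col_mx B1 B2) = mxdot A1 B1 + mxdot A2 B2.
Proof. by rewrite /mxdot tr_col_mx mul_row_col mxtraceD. Qed.

Lemma mxdot_scalar1 (R : realType) (a b : R) : mxdot (a%:M : 'M[R]_1) b%:M = a * b.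
Proof. by rewrite /mxdot tr_scalar_mx -scalar_mxM mxtrace_scalar mulr1n. Qed.

Lemma scalar_mxdot (R : realType) (n : nat) (c v : 'cV[R]_n) : c^T *m v = (mxdot c v)%:M.
Proof. by apply/matrixP => i j; rewrite mxdot_cV !ord1 [RHS]mxE eqxx mulr1n. Qed.

Lemma sub1_block (R : realType) (p : nat) (a : R) (c : 'cV[R]_p) (G : 'M[R]_p) :
  1%:M - block_mx a%:M c^T c G =
  block_mx (1 - a)%:M (- c)^T (- c) (1%:M - G) :> 'M[R]_(1 + p).
Proof.
rewrite scalar_mx_block opp_block_mx add_block_mx !sub0r linearN /=.
by rewrite [(1 - a)%:M]raddfB.
Qed.

(* Gaussian elimination on [1 - G]: integrating out the first coordinate replaces
   [1 - G] by its Schur complement. *)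
Lemma gaussian_expR_quad (d : measure_display) (Om : measurableType d) (R : realType)
    (P : probability Om R) (p : nat) (eta : 'I_p -> {RV P >-> R})
    (G : 'M[R]_p) (b u : 'cV[R]_p) :
  independent_RVs eta ->
  (forall j B, measurable B -> distribution P (eta j) B = normal_prob 0 1 B) ->
  posdef (1%:M - G) -> (1%:M - G) *m u = b ->
  (\int[P]_w (let X := \col_j eta j w in
     expR (2^-1 * mxdot X (G *m X) + mxdot b X))%:E =
   ((Num.sqrt (\det (1%:M - G)))^-1 * expR (2^-1 * mxdot b u))%:E)%E.
Proof.
elim: p eta G b u => [|p IH] eta G b u indep law Np Nu.
  under eq_integral => w _.
    rewrite /mxdot !(thinmx0 (_^T)) !mul0mx !mxtrace0 mulr0 addr0 expR0; over.
  rewrite integral_cst // [X in (1 * X)%E](@probability_setT _ _ _ P) mule1 det_mx00 sqrtr1 invr1 mul1r.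
  by rewrite (flatmx0 b) mxdot0l mulr0 expR0.
have Gs : G^T = G.
  by have := Np.1; rewrite linearB /= trmx1 => /addrI/oppr_inj.
move: Np Nu; rewrite (@sym_blockE R p G Gs).
move: (G 0 0) (@dlsubmx _ 1 p 1 p G) (@drsubmx _ 1 p 1 p G) => a c G1.
have col_split (v : 'cV[R]_(1 + p)) : v = col_mx (v 0 0)%:M (dsubmx v).
  rewrite -[LHS]vsubmxK; congr col_mx; apply/matrixP => i j.
  by rewrite !mxE !ord1 eqxx mulr1n; congr (v _ _); apply/val_inj.
rewrite (col_split b) (col_split u).
move: (b 0 0) (@dsubmx _ 1 p 1 b) (u 0 0) (@dsubmx _ 1 p 1 u) => b0 b1 u0 u1.
rewrite [_ - _](@sub1_block R p) => Np; have := Np => /posdef_block[n0].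
set n := 1 - a in n0 Np *.
rewrite det_block ?gt_eqF // linearN /= mulNmx mulmxN opprK.
(* The quadratic part left after the first coordinate is integrated out; 1 - G2 is the Schur
   complement of n in 1 - G. *)
pose G2 := G1 + n^-1 *: (c *m c^T).
have G2E : 1%:M - G2 = 1%:M - G1 - n^-1 *: (c *m c^T) by rewrite /G2 opprD addrA.
rewrite -G2E => N2p; rewrite [_ *m _](@mul_block_col _ 1 p 1 p 1) => E; have [E0 E1] := @eq_col_mx _ 1 p 1 _ _ _ _ E.
have {}E0 : n * u0 = b0 + mxdot c u1.
  move/matrixP/(_ 0 0): E0; rewrite mulNmx scalar_mxdot -scalar_mxM !mxE eqxx !mulr1n => <-.
  by rewrite subrK.
(* The lower block of u solves the reduced system, so the induction hypothesis applies to [u1] with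
   no inverse to compute. *)
have {}E1 : (1%:M - G2) *m u1 = b1 + (n^-1 * b0) *: c.
  rewrite G2E mulmxBl -E1 -scalemxAl -mulmxA scalar_mxdot !mul_mx_scalar scalerN.
  rewrite (_ : n^-1 * b0 = u0 - n^-1 * mxdot c u1); last first.
    by rewrite -[b0](addrK (mxdot c u1)) -E0 mulrBr mulKf // gt_eqF.
  by rewrite scalerBl scalerA !addrA [- (u0 *: c) + _]addrC subrK.
pose T := RVtuple (fun i => eta (lift ord0 i)).
have XE w : \col_j eta j w = col_mx (eta ord0 w)%:M (col_tuple (T w)).
  apply/matrixP => i j; rewrite mxE [RHS]mxE ord1; case: splitP => k kE.
    have -> : i = ord0 by apply: val_inj; rewrite /= kE ord1.
    by rewrite (ord1 k) !mxE eqxx mulr1n.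
  have -> : i = lift ord0 k by apply: val_inj.
  by rewrite !mxE tnth_mktuple.
(* The first factor carries all terms with the first coordinate, whose linear coefficient includes
   the cross term with the others; the second factor is constant in it. *)
pose f (y : measurableTypeR R * p.-tuple R) : \bar R := (
  expR (2^-1 * (a * y.1 ^+ 2) + (b0 + mxdot c (col_tuple y.2)) * y.1) *
  expR (2^-1 * mxdot (col_tuple y.2) (G1 *m col_tuple y.2) + mxdot b1 (col_tuple y.2)))%:E.
have mf : measurable_fun setT f.
  have m1 := measurable_mxdot_col_tuple; have m2 := @measurable_quad_col_tuple R p G1.
  apply/measurable_EFinP; apply: measurable_funM; apply: measurableT_comp => //.
    apply: measurable_funD; apply: measurable_funM => //.
      by apply: measurable_funM => //; apply: measurable_funX.
    by apply: measurable_funD => //; exact: measurableT_comp (m1 _ _ c) _.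
  apply: measurable_funD; last exact: measurableT_comp (m1 _ _ b1) _.
  by apply: measurable_funM => //; exact: measurableT_comp m2 _.
have f0 y : (0 <= f y)%E by rewrite lee_fin mulr_ge0 ?expR_ge0.
transitivity (\int[P]_w f (eta ord0 w, T w))%E.
  apply: eq_integral => w _; congr _%:E; rewrite /= -expRD XE; congr expR.
  rewrite [X in 2^-1 * mxdot _ X + _ = _](@mul_block_col _ 1 p 1 p 1) !(@mxdot_col_mx R 1 p 1).
  rewrite !mxdotDr scalar_mxdot -scalar_mxM !mxdot_scalar1.
  rewrite mul_mx_scalar mxdotZr [mxdot _ c]mxdotC.
  by field.
rewrite (expectation_independent_head (nu := normal_prob 0 1)) //; last exact: law.
transitivity (\int[P]_w (((Num.sqrt n)^-1 * expR (2^-1 * (n^-1 * b0 ^+ 2)))%:E *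
   (expR (2^-1 * mxdot (\col_j eta (lift ord0 j) w) (G2 *m (\col_j eta (lift ord0 j) w)) +
     mxdot (b1 + (n^-1 * b0) *: c) (\col_j eta (lift ord0 j) w)))%:E))%E.
  apply: eq_integral => w _; rewrite -col_RVtuple -/T /f /=.
  under eq_integral do rewrite mulrC EFinM.
  rewrite ge0_integralZl //; last first.
    have mq : measurable_fun setT (fun x : R =>
        (expR (2^-1 * (a * x ^+ 2) + (b0 + mxdot c (col_tuple (T w))) * x))%:E).
      apply/measurable_EFinP; apply: measurableT_comp => //.
      by apply: measurable_funD => //; do 2 apply: measurable_funM => //;
        apply: measurable_funX.
    exact: mq.
  rewrite integral_normal_expR_quad // -!EFinM; congr _%:E; rewrite -/n.
  rewrite mulrCA -mulrA -!expRD; congr (_ * expR _).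
  rewrite mulmxDl -scalemxAl -mulmxA scalar_mxdot mul_mx_scalar mxdotDr !mxdotZr mxdotDl mxdotZl.
  by rewrite [mxdot _ c]mxdotC; field; rewrite gt_eqF.
rewrite ge0_integralZl //; last first.
  apply/measurable_EFinP; apply: measurableT_comp => //; exact: measurable_quad_RV.
have -> := IH (fun j => eta (lift ord0 j)) G2 (b1 + (n^-1 * b0) *: c) u1
  (independent_RVs_tail indep) (fun j => law _) N2p E1.
rewrite -EFinM; congr _%:E; rewrite sqrtrM ?(ltW n0) // invfM mulrACA -expRD.
congr (_ * expR _); rewrite (@mxdot_col_mx R 1 p 1) mxdot_scalar1 mxdotDl mxdotZl.
have -> : mxdot c u1 = n * u0 - b0 by rewrite E0 addrC addKr.
by field; rewrite gt_eqF.
Qed.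

(** * The detectors *)

(** The form is nonnegative at the sum and at the difference of two basis vectors, which bounds 2 |W
    i j| by the sum of two diagonal entries, each at most the trace. *)
Lemma psd_entry_le (R : realType) (n : nat) (W : 'M[R]_n) (i j : 'I_n) :
  psdmx W -> `|W i j| <= \tr W.
Proof.
move=> /psdmxP[Ws Wp].
have dotE (a b : 'I_n) : mxdot (delta_mx a 0 : 'cV[R]_n) (W *m delta_mx b 0) = W a b.
  by rewrite mxdot_cV trmx_delta -colE -rowE !mxE.
have d0 k : 0 <= W k k by rewrite -dotE.
have dtr k : W k k <= \tr W.
  by rewrite /mxtrace (bigD1 k) //= lerDl sumr_ge0.
have Wji : W j i = W i j by rewrite -{1}Ws mxE.
have := Wp (delta_mx i 0 + delta_mx j 0); have := Wp (delta_mx i 0 - delta_mx j 0).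
rewrite !mulmxBr !mulmxDr !mxdotBl !mxdotDl !mxdotBr !mxdotDr !dotE Wji ler_norml.
by have := dtr i; have := dtr j; have := d0 i; have := d0 j; lra.
Qed.

(** A crude bound, used to show that the sets under the suprema are bounded above. *)
Lemma psd_tr_mul_le (R : realType) (n : nat) (W Y : 'M[R]_n) :
  psdmx W -> \tr (W *m Y) <= \tr W * \sum_i \sum_j `|Y j i|.
Proof.
move=> Wp; rewrite /mxtrace mulr_sumr; apply: ler_sum => i _.
rewrite mxE mulr_sumr; apply: ler_sum => j _.
rewrite (le_trans (ler_norm _)) // normrM ler_wpM2r //.
exact: psd_entry_le.
Qed.

Lemma psd_mulVT (R : realType) (m n : nat) (v : 'M[R]_(m, n)) : psdmx (v *m v^T).
Proof.
apply/psdmxP; split=> [|w]; first by rewrite trmx_mul trmxK.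
by rewrite -mulmxA mxdot_mull mxdot_ge0.
Qed.

Lemma lemx_congr (R : realType) (m n : nat) (A B : 'M[R]_n) (S : 'M[R]_(m, n)) :
  lemx A B -> lemx (S *m A *m S^T) (S *m B *m S^T).
Proof.
move=> /psdmxP[Es Ep]; apply/psdmxP; rewrite -mulmxBl -mulmxBr; split=> [|v].
  by rewrite !trmx_mul trmxK Es mulmxA.
by rewrite -!mulmxA mxdot_mull.
Qed.

Lemma posdef_row_free (R : realType) (m n : nat) (A : 'M[R]_n) (S : 'M[R]_(m, n)) :
  posdef A -> row_free S -> posdef (S *m A *m S^T).
Proof.
move=> [As Ap] Sf; split=> [|v v0]; first by rewrite !trmx_mul trmxK As mulmxA.
rewrite -!mulmxA mxdot_mull Ap //; apply: contra_neq v0 => /(congr1 trmx).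
rewrite trmx_mul trmxK trmx0 => vS; apply: trmx_inj; rewrite trmx0.
by apply: (row_free_inj Sf); rewrite vS mul0mx.
Qed.

(** Subtracting a small multiple of the identity stays in the cone, so the form of A at v exceeds a
    positive multiple of the square of |v|. *)
Lemma psd_interior_posdef (R : realType) (n : nat) (A : 'M[R]_n) :
  psd_interior A -> posdef A.
Proof.
move=> [As]; rewrite -[X in X -> _]/(nbhs A _) => /nbhs_ballP[e e0 Ae].
split=> // v v0; pose B := A - (e / 2)%:M.
have AB : ball A e B.
  split=> // i j; rewrite !mxE /ball /= opprB addrC subrK.
  have [_|_] := eqVneq i j; rewrite ?mulr1n ?mulr0n ?normr0 //.
  by rewrite gtr0_norm ?divr_gt0 // ltr_pdivrMr // ltr_pMr // ltr1n.
have Bs : symmx B by rewrite /symmx /= linearB /= tr_scalar_mx As.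
have /psdmxP[_ /(_ v)] := Ae _ AB Bs.
rewrite mulmxBl mxdotBr mul_scalar_mx mxdotZr subr_ge0; apply: lt_le_trans.
by rewrite mulr_gt0 ?divr_gt0 // mxdot_gt0.
Qed.

Lemma expR_ln_sqrt (R : realType) (x : R) : 0 < x ->
  expR (- 2^-1 * ln x) = (Num.sqrt x)^-1.
Proof.
move=> x0; rewrite mulNr expRN; congr (_^-1).
have e0 := expR_ge0 (2^-1 * ln x).
rewrite -[LHS]ger0_norm // -sqrtr_sqr; congr Num.sqrt.
by rewrite -expRM_natl -mulr_natl mulrA divff // mul1r lnK.
Qed.

(** In the standard variables, with xi = A eta, the exponent has quadratic part A^T H A and linear
    part A^T g, so the integral is explicit. [ln_det_perturb] bounds its determinant, which depends
    on A only through A A^T = Th, and [quad_form_le] its exponent. *)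
Lemma gaussian_quad_bound (d : measure_display) (Om : measurableType d) (R : realType)
    (P : probability Om R) (m : nat) (xi : Om -> 'cV[R]_m) (mu h : 'cV[R]_m)
    (H Th T : 'M[R]_m) (delta c : R)
    (G := sqrtmx T *m H *m sqrtmx T) (g := H *m mu + h) :
  centered_gaussian P xi Th -> posdef T -> lemx Th T -> H^T = H ->
  lemx (- (c *: invmx T)) H -> lemx H (c *: invmx T) -> 0 <= c < 1 ->
  specnorm (sqrtmx Th *m invmx (sqrtmx T) - 1%:M) <= delta ->
  (\int[P]_w (expR (2^-1 * mxdot (mu + xi w) (H *m (mu + xi w)) + mxdot h (mu + xi w)))%:E
   <= (expR (- 2^-1 * ln (\det (1%:M - G)) + 2^-1 * \tr ((Th - T) *m H)
       + delta * (2 + delta) / (2 * (1 - specnorm G)) * frobnorm G ^+ 2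
       + 2^-1 * (mxdot mu (H *m mu) + 2 * mxdot h mu
                 + mxdot g (invmx (invmx T - H) *m g))))%:E)%E.
Proof.
move=> [p [A [eta [AA indep law xiE]]]] Tp TT Hs Hl Hu /andP[c0 c1] dl.
have Gc : opbound G c := opbound_scaled Tp c0 Hs Hl Hu.
have s1 : specnorm G < 1 := le_lt_trans (specnorm_le Gc) c1.
have Thp : psdmx Th by rewrite -AA; exact: psd_mulVT.
have [det0 detle] := ln_det_perturb Tp Thp TT Hs s1 dl.
rewrite -{1}AA in TT.
pose N := 1%:M - A^T *m H *m A.
have Np : posdef N.
  apply: posdef_1B (opbound_congr Tp TT Gc) c1.
  by rewrite !trmx_mul trmxK Hs mulmxA.
pose u := invmx N *m (A^T *m g).
have Nu : N *m u = A^T *m g by rewrite mulKVmx ?posdef_unit.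
have uE : u = A^T *m (g + H *m (A *m u)).
  rewrite mulmxDr -Nu mulmxBl mul1mx !mulmxA subrK //.
have quad := quad_form_le Tp TT (posdef_invB Tp Hs c1 Hu) uE.
have detN : \det N = \det (1%:M - H *m Th) by rewrite /N -mulmxA det_1BmulC -mulmxA AA.
under eq_integral => w _.
  have -> : 2^-1 * mxdot (mu + xi w) (H *m (mu + xi w)) + mxdot h (mu + xi w) =
     (2^-1 * mxdot mu (H *m mu) + mxdot h mu) +
     (2^-1 * mxdot (\col_j eta j w) ((A^T *m H *m A) *m (\col_j eta j w)) +
      mxdot (A^T *m g) (\col_j eta j w)).
    rewrite xiE; move: (\col_j _) => X.
    rewrite -!mulmxA [mxdot (A^T *m g) X]mxdotC !(mxdot_mull X) !trmxK.
    rewrite /g !mulmxDr !mxdotDl !mxdotDr.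
    rewrite (mxdot_mull mu H (A *m X)) Hs [mxdot (H *m mu) _]mxdotC [mxdot h (A *m X)]mxdotC.
    by field.
  rewrite expRD EFinM; over.
rewrite ge0_integralZl //; first last.
  apply/measurable_EFinP; apply: measurableT_comp => //; exact: measurable_quad_RV.
rewrite (gaussian_expR_quad indep law Np Nu) -EFinM lee_fin detN -expR_ln_sqrt //.
rewrite -!expRD ler_expR.
have -> : mxdot (A^T *m g) u = mxdot g (A *m u) by rewrite mxdot_mull.
lra.
Qed.

(** * Consequences of the assumptions on the model *)

Section ModelFacts.
Context (R : realType) (M : model R) (hM : model_ok M).
Variable t : nat.
Hypothesis ht : (1 <= t <= horizon M)%N.

Lemma Ucov_posdef Th : Ucov M Th -> posdef Th.
Proof. by move=> /(Ucov_interior hM)/psd_interior_posdef. Qed.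

Lemma Smx_row_free : row_free (Smx M t).
Proof. by rewrite /row_free Smx_rank. Qed.

Lemma Ucov_t_posdef Th : Ucov_t M t Th -> posdef Th.
Proof.
by move=> [Th' /Ucov_posdef Thp <-]; apply: posdef_row_free Thp Smx_row_free.
Qed.

Lemma Ucov_t_le Th : Ucov_t M t Th -> lemx Th (Thstar M t).
Proof. by move=> [Th' /(Thstar_ge hM) TT <-]; apply: lemx_congr. Qed.

Lemma Thstar_posdef : posdef (Thstar M t).
Proof.
have [Th ThU] := Ucov_neq0 hM.
have ThUt : Ucov_t M t (Smx M t *m Th *m (Smx M t)^T) by exists Th.
exact: posdef_ge (Ucov_t_posdef ThUt) (Ucov_t_le ThUt).
Qed.

Lemma calHN h H : calH M t (h, H) -> calH M t (- h, - H).
Proof.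
rewrite /calH /symmx /lemx /= => -[Hs Hl Hu]; split.
- by rewrite linearN /= Hs.
- by rewrite opprK addrC.
- by rewrite opprK addrC -[_ *: _]opprK.
Qed.

(** Only the trace term depends on Th, and Th is dominated by [Thstar M t]. This makes the inner
    supremum in [SV] finite. *)
Lemma Ffun_ub Z (h : 'cV[R]_(nu M t)) (H : 'M[R]_(nu M t)) :
  exists C, forall Th, Ucov_t M t Th -> Ffun Z h H Th <= C.
Proof.
pose B := \tr (Thstar M t) * (\sum_i \sum_j `|H j i|) - \tr (Thstar M t *m H).
pose F0 := Ffun Z h H (Thstar M t).
exists (F0 + 2^-1 * B) => Th ThU.
have trTh : \tr (Th *m H) - \tr (Thstar M t *m H) <= B.
  rewrite lerD2r (le_trans (psd_tr_mul_le H (posdef_psd (Ucov_t_posdef ThU)))) //.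
  apply: ler_wpM2r; first by apply: sumr_ge0 => i _; apply: sumr_ge0.
  rewrite -subr_ge0 -linearB /=; have /psdmxP[_ TTh] := Ucov_t_le ThU.
  apply: sumr_ge0 => i _; have := TTh (delta_mx i 0).
  by rewrite mxdot_cV trmx_delta -colE -rowE !mxE.
rewrite /F0 /Ffun subrr mul0mx mxtrace0 mulr0 addr0 mulmxBl linearB /=.
by move: trTh; set x := \tr _; set y := \tr _; move: (- 2^-1 * _) (_ / _ * _) (2^-1 * support_fun _ _) => *; lra.
Qed.

(** For each admissible (h, H), the inner supremum is at least the cost at the saddle covariances,
    and there the saddle point minimizes the cost. *)
Lemma SV_ge (k : 'I_(nshapes M)) (r : R) (s : saddle M t) : is_saddle k r s ->
  cost k r (sp_h s) (sp_H s) (sp_Th1 s) (sp_Th2 s) <= SV t k r.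
Proof.
move=> [zH U1 U2 smin _]; apply: lb_le_inf.
  by exists (sup [set cost k r (sp_h s) (sp_H s) Th.1 Th.2 | Th in Ucov_t M t `*` Ucov_t M t]);
     exists (sp_h s, sp_H s).
move=> _ [[h H] hH <-]; apply: le_trans (smin _ _ hH) _.
apply: sup_upper_bound; last by exists (sp_Th1 s, sp_Th2 s).
split; first by exists (cost k r h H (sp_Th1 s) (sp_Th2 s)); exists (sp_Th1 s, sp_Th2 s).
have [C1 hC1] := Ffun_ub (calN M) (- h) (- H).
have [C2 hC2] := Ffun_ub (calZ k r) h H.
exists (2^-1 * (C1 + C2)) => _ [[Th1 Th2] /= [/hC1 h1 /hC2 h2] <-].
by rewrite /cost ler_wpM2l // lerD.
Qed.

Lemma Zmx_lifted (x : 'cV[R]_(dimx M)) : lifted M (Zmx x).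
Proof.
split; first exact: psd_mulVT.
by rewrite /Zmx tr_col_mx mul_col_row block_mxKdr trmx1 mulmx1.
Qed.

Lemma Zmx_lifted_inputs m x : inputs M m x -> lifted_inputs M m (Zmx x).
Proof.
by move=> xm; split=> [|i /xm]; [exact: Zmx_lifted|rewrite mxtrace_mulC].
Qed.

(** The first constraint bounds the trace of the upper left block by the squared radius, and the
    corner entry is 1. *)
Lemma lifted_inputs_trace m W : (1 <= m)%N -> lifted_inputs M m W ->
  \tr W <= Defs.radius M ^+ 2 + 1.
Proof.
move=> m1 [[_ Wdr] /(_ 1%N)]; rewrite m1 (qin1 hM) (Qin1 hM) => /(_ isT).
rewrite -[in X in X -> _](submxK W) mulmx_block !mulmx0 !mulmx1 !addr0 mxtrace_block mxtrace0.
rewrite -[in X in _ -> X](submxK W) mxtrace_block Wdr mxtrace1; lra.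
Qed.

Lemma support_fun_ge m (Z : set 'M[R]_(dimx M + 1)) W Y : (1 <= m)%N ->
  Z `<=` lifted_inputs M m -> Z W -> \tr (W *m Y) <= support_fun Z Y.
Proof.
move=> m1 Zm ZW; apply: sup_upper_bound; last by exists W.
split; first by exists (\tr (W *m Y)); exists W.
exists ((Defs.radius M ^+ 2 + 1) * \sum_i \sum_j `|Y j i|) => _ [W' /Zm W'm <-].
have [[W'p _] _] := W'm.
apply: le_trans (psd_tr_mul_le Y W'p) _.
apply: ler_wpM2r; first by apply: sumr_ge0 => i _; apply: sumr_ge0.
exact: lifted_inputs_trace W'm.
Qed.

Lemma tr_Zmx (x : 'cV[R]_(dimx M)) Q : \tr (Q *m Zmx x) =
  mxdot (col_mx x 1%:M) (Q *m col_mx x 1%:M).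
Proof. by rewrite /Zmx mulmxA mxtrace_mulC. Qed.

Lemma mgf_le_Ffun m Z (h : 'cV[R]_(nu M t)) (H : 'M[R]_(nu M t)) (dsp : measure_display)
    (Om : measurableType dsp) (P : probability Om R) Theta xi x :
  (1 <= m)%N -> Z `<=` lifted_inputs M m -> Z (Zmx x) -> calH M t (h, H) ->
  Ucov M Theta -> centered_gaussian P xi Theta ->
  (\int[P]_w (let y := observations x (xi w) t in
     expR (2^-1 * mxdot y (H *m y) + mxdot h y))%:E <=
  (expR (Ffun Z h H (Smx M t *m Theta *m (Smx M t)^T)))%:E)%E.
Proof.
move=> m1 Zm Zx [Hs Hl Hu] ThU gauss; set Th := _ *m _ *m _.
have ThUt : Ucov_t M t Th by exists Theta.
have gauss_t : centered_gaussian P (fun w => Smx M t *m xi w) Th.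
  have [p [A [eta [AA indep law xiE]]]] := gauss.
  exists p, (Smx M t *m A), eta; split=> // [|w]; last by rewrite xiE mulmxA.
  by rewrite trmx_mul /Th -AA !mulmxA.
have /andP[g0 g1] := gamma_in hM.
have := gaussian_quad_bound (Abar M t *m x) h gauss_t Thstar_posdef (Ucov_t_le ThUt)
  Hs Hl Hu _ (delta_ge hM ht ThUt).
rewrite (ltW g0) g1 => /(_ isT)/le_trans; apply.
rewrite lee_fin ler_expR lerD2l ler_wpM2l //.
(* The matrix B_t maps [x; 1] to [Abar_t x; 1], so the last term of the Gaussian bound is the trace
   against Z(x) of the matrix inside the support function. *)
apply: le_trans (support_fun_ge _ m1 Zm Zx).
have BE : Bmx M t *m col_mx x 1%:M = col_mx (Abar M t *m x) 1%:M.
  by rewrite /Bmx /Amx mul_col_mx !mul_row_col !mul0mx mul1mx addr0 add0r.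
move: (Abar M t *m x) BE => /= mu BE.
rewrite mxtrace_mulC tr_Zmx -!mulmxA (mxdot_mull (col_mx x 1%:M)) trmxK BE.
rewrite mulmxDl mxdotDr -!mulmxA (mxdot_mull _ (row_mx H h)^T) trmxK mul_row_col mulmx1.
rewrite lerD2r mul_block_col mxdot_col_mx mul0mx addr0 mulmx1.
by rewrite scalar_mxdot mxdot_scalar1 mul1r mxdotDr (mxdotC mu h); lra.
Qed.

End ModelFacts.

(** * Markov and union bounds, and the stopping rule *)

Lemma measurable_ge (dsp : measure_display) (Om : measurableType dsp) (R : realType)
    (Y : Om -> R) (a : R) : measurable_fun setT Y -> measurable [set w | a <= Y w].
Proof.
move=> mY; rewrite (_ : [set _ | _] = setT `&` Y @^-1` `[a, +oo[).
  by apply: mY => //; exact: measurable_itv.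
by rewrite setTI; apply/seteqP; split=> w /=; rewrite in_itv /= andbT.
Qed.

(** The indicator of the event is at most exp (Y - a), because 1 + (Y - a) is. *)
Lemma markov_expR (dsp : measure_display) (Om : measurableType dsp) (R : realType)
    (P : probability Om R) (Y : Om -> R) (a : R) : measurable_fun setT Y ->
  (P [set w | (a <= Y w)%R] <= (expR (- a))%:E * \int[P]_w (expR (Y w))%:E)%E.
Proof.
move=> mY.
have mA := measurable_ge a mY.
have mE : measurable_fun setT (fun w => (expR (Y w))%:E).
  by apply/measurable_EFinP; exact: measurableT_comp.
rewrite -[X in P X]setIT -integral_indic // -ge0_integralZl //.
apply: ge0_le_integral => //.
- by apply/measurable_EFinP; exact: measurable_indic.
- exact: emeasurable_funM.
move=> w _; rewrite -EFinM lee_fin -expRD indicE.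
have [|_] := boolP (w \in _); last exact: expR_ge0.
rewrite inE /= => aY; apply: le_trans (expR_ge1Dx _).
by rewrite lerDl addrC subr_ge0.
Qed.

Lemma measurable_lt (dsp : measure_display) (Om : measurableType dsp) (R : realType)
    (Y : Om -> R) (a : R) : measurable_fun setT Y -> measurable [set w | Y w < a].
Proof.
move=> mY; rewrite (_ : [set _ | _] = setT `&` Y @^-1` `]-oo, a[).
  by apply: mY => //; exact: measurable_itv.
by rewrite setTI; apply/seteqP; split=> w /=; rewrite in_itv.
Qed.

Lemma measure_bigsetU_le (dsp : measure_display) (Om : measurableType dsp) (R : realType)
    (P : probability Om R) (I : finType) (A : I -> set Om) (Q : pred I) :
  (forall i, measurable (A i)) ->
  (P (\big[setU/set0]_(i | Q i) A i) <= \sum_(i | Q i) P (A i))%E.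
Proof.
move=> mA; suff : measurable (\big[setU/set0]_(i | Q i) A i) /\
    (P (\big[setU/set0]_(i | Q i) A i) <= \sum_(i | Q i) P (A i))%E by case.
elim/big_rec2: _ => [|i x U _ [mU Ux]]; first by rewrite measure0.
split; first exact: measurableU.
by rewrite (le_trans (measureU2 _ _ _)) // leeD2l.
Qed.

Lemma procedure_Some (R : realType) (M : model R) (rho : nat -> 'I_(nshapes M) -> \bar R)
    (sp : forall t, 'I_(nshapes M) -> saddle M t) (y : forall t, 'cV[R]_(nu M t)) (s : nat) :
  procedure rho sp y = Some s -> (1 <= s <= horizon M)%N /\ alarm rho sp y s.
Proof.
rewrite /procedure; case E: (seq.filter _ _) => [|s' l] //= [ss'].
have : s \in [seq t <- iota 1 (horizon M) | `[< alarm rho sp y t >]].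
  by rewrite E -ss' mem_head.
by rewrite mem_filter mem_iota add1n ltnS => /andP[/asboolP].
Qed.

(** The procedure stops at its first alarm, so an alarm at time s forces termination at s or
    earlier. *)
Lemma procedure_le (R : realType) (M : model R) (rho : nat -> 'I_(nshapes M) -> \bar R)
    (sp : forall t, 'I_(nshapes M) -> saddle M t) (y : forall t, 'cV[R]_(nu M t)) (t : nat) :
  (t <= horizon M)%N ->
  (exists s, (s <= t)%N /\ procedure rho sp y = Some s) <->
  (exists s, (1 <= s <= t)%N /\ alarm rho sp y s).
Proof.
move=> td; split=> [[s [st /procedure_Some[/andP[s1 _] sa]]]|[s [/andP[s1 st] sa]]].
  by exists s; rewrite s1 st.
rewrite /procedure.
(* Cut the time range after s: the filtered first segment contains s, so the head of the whole list
   lies in it. *)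
have -> : horizon M = (s + (horizon M - s))%N by rewrite subnKC // (leq_trans st).
rewrite iotaD filter_cat.
case E: (seq.filter _ (iota 1 s)) => [|s' l] /=.
  have : s \in [seq t <- iota 1 s | `[< alarm rho sp y t >]].
    by rewrite mem_filter mem_iota s1 add1n ltnS leqnn !andbT; apply/asboolP.
  by rewrite E.
exists s'; split=> //; have : s' \in [seq t <- iota 1 s | `[< alarm rho sp y t >]].
  by rewrite E mem_head.
by rewrite mem_filter mem_iota add1n ltnS => /and3P[_ _ /leq_trans]; apply.
Qed.

(** The detector without its additive constant, so that changing the signs of h and H changes its
    sign. *)
Definition quad_stat (R : realType) (n : nat) (h : 'cV[R]_n) (H : 'M[R]_n)
    (y : 'cV[R]_n) : R :=
  2^-1 * mxdot y (H *m y) + mxdot h y.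

Lemma detectorE (R : realType) (M : model R) (t : nat) (k : 'I_(nshapes M)) (r : R)
    (s : saddle M t) (y : 'cV[R]_(nu M t)) :
  detector k r s y = quad_stat (sp_h s) (sp_H s) y +
    2^-1 * (Ffun (calN M) (- sp_h s) (- sp_H s) (sp_Th1 s)
            - Ffun (calZ k r) (sp_h s) (sp_H s) (sp_Th2 s)).
Proof. by rewrite /detector /quad_stat !mxdot_cV mulmxA. Qed.

Lemma quad_statN (R : realType) (n : nat) (h : 'cV[R]_n) (H : 'M[R]_n) (y : 'cV[R]_n) :
  quad_stat (- h) (- H) y = - quad_stat h H y.
Proof. by rewrite /quad_stat mulNmx mxdotNr mxdotNl mulrN opprD. Qed.

(** * The procedure *)

Section Procedure.
Context (R : realType) (M : model R) (hM : model_ok M).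
Context (dsp : measure_display) (Om : measurableType dsp) (P : probability Om R).
Context (Theta : 'M[R]_(nu M (horizon M))) (hTheta : Ucov M Theta).
Context (xi : Om -> 'cV[R]_(nu M (horizon M))) (hxi : centered_gaussian P xi Theta).
Context (x : 'cV[R]_(dimx M)).

Let obs w t := observations x (xi w) t.

Lemma measurable_quad_stat t h H : measurable_fun setT (fun w => quad_stat h H (obs w t)).
Proof.
have [p [A [eta [_ _ _ xiE]]]] := hxi.
pose B := Smx M t *m A; pose mu := Abar M t *m x.
(* Here H is arbitrary, so the two cross terms contribute H mu and H^T mu separately. *)
pose b := B^T *m (2^-1 *: (H *m mu + H^T *m mu) + h).
have -> : (fun w => quad_stat h H (obs w t)) = fun w =>
    (2^-1 * mxdot (\col_j eta j w) ((B^T *m H *m B) *m \col_j eta j w)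
     + mxdot b (\col_j eta j w)) + (2^-1 * mxdot mu (H *m mu) + mxdot h mu).
  apply/funext => w; rewrite /quad_stat /obs /observations xiE mulmxA -/B -/mu.
  move: (\col_j _) => X; rewrite /b; clearbody B mu.
  rewrite [mxdot (B^T *m _) X]mxdotC -!mulmxA !(mxdot_mull X) !trmxK.
  rewrite !mulmxDr !mxdotDl !mxdotDr mxdotZr mxdotDr (mxdot_mull mu H (B *m X)).
  by rewrite [mxdot (H^T *m mu) _]mxdotC [mxdot h (B *m X)]mxdotC; field.
apply: measurable_funD => //; exact: measurable_quad_RV.
Qed.

Lemma measurable_detector t k r (s : saddle M t) :
  measurable_fun setT (fun w => detector k r s (obs w t)).
Proof.
under eq_fun do rewrite detectorE.
by apply: measurable_funD => //; exact: measurable_quad_stat.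
Qed.

Lemma mgf_quad_stat t h H m Z c : (1 <= t <= horizon M)%N -> (1 <= m)%N ->
  Z `<=` lifted_inputs M m -> Z (Zmx x) -> calH M t (h, H) ->
  (\int[P]_w (expR (quad_stat h H (obs w t) + c))%:E <=
   (expR (Ffun Z h H (Smx M t *m Theta *m (Smx M t)^T) + c))%:E)%E.
Proof.
move=> ht m1 Zm Zx hH; under eq_integral do rewrite addrC expRD EFinM.
rewrite ge0_integralZl //; last first.
  apply/measurable_EFinP; apply: measurableT_comp => //; exact: measurable_quad_stat.
rewrite [_ + c]addrC expRD [leRHS]EFinM lee_wpmul2l ?lee_fin ?expR_ge0 //.
exact: (mgf_le_Ffun hM ht m1 Zm Zx hH hTheta hxi).
Qed.

(** By the saddle inequality with the second covariance fixed, the nuisance term at the true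
    covariance is at most its value at [sp_Th1 s]. Subtracting the constant a leaves half the sum of
    the two terms, which is the saddle value. *)
Lemma nuisance_mgf t k r (s : saddle M t) : (1 <= t <= horizon M)%N ->
  is_saddle k r s -> nuisance M x ->
  (\int[P]_w (expR (- detector k r s (obs w t)))%:E <= (expR (SV t k r))%:E)%E.
Proof.
move=> ht ss hx; have SVge := SV_ge hM ht ss; have [zH U1 U2 _ smax] := ss.
under eq_integral do rewrite detectorE opprD -quad_statN.
have m1 : (1 <= cplus M)%N by rewrite (leq_trans (cadm_gt0 hM)) // ltnW // cadm_lt.
apply: le_trans (mgf_quad_stat _ ht m1 (@subset_refl _ _) (Zmx_lifted_inputs hx) (calHN zH)) _.
rewrite lee_fin ler_expR.
have ThU : Ucov_t M t (Smx M t *m Theta *m (Smx M t)^T) by exists Theta.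
by have := smax _ _ ThU U2; move: SVge; rewrite /cost; lra.
Qed.

(** The mirror image, with the first covariance fixed: adding a to the signal term leaves the same
    half-sum. *)
Lemma signal_mgf t k r (s : saddle M t) : (1 <= t <= horizon M)%N ->
  is_saddle k r s -> calZ k r (Zmx x) ->
  (\int[P]_w (expR (detector k r s (obs w t)))%:E <= (expR (SV t k r))%:E)%E.
Proof.
move=> ht ss hx; have SVge := SV_ge hM ht ss; have [zH U1 U2 _ smax] := ss.
under eq_integral do rewrite detectorE.
apply: le_trans (mgf_quad_stat _ ht (cadm_gt0 hM) (@subIsetr _ _ _) hx zH) _.
rewrite lee_fin ler_expR.
have ThU : Ucov_t M t (Smx M t *m Theta *m (Smx M t)^T) by exists Theta.
by have := smax _ _ U1 ThU; move: SVge; rewrite /cost; lra.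
Qed.

(** With x = r z, type A constraints are linear in z and scale by r, type B ones are quadratic and
    scale by its square. As the right-hand sides are nonpositive, replacing r by the smaller r0
    weakens them. *)
Lemma calZ_signal k r r0 : admissible M x -> 0 < r0 <= r -> signal k r x ->
  calZ k r0 (Zmx x).
Proof.
move=> hx /andP[r0p r0r] [z zk xE]; split; last exact: Zmx_lifted_inputs.
split; first exact: Zmx_lifted.
split=> i ti; have := zk i; rewrite !tr_Zmx -xE -[Qsig i]submxK !mul_block_col.
  have [-> ->] := typeA_blocks hM ti.
  rewrite !mul0mx !add0r !addr0 !mulmx1 !mxdot_col_mx -scalemxAr !mxdotZl !mxdotZr -mulrDr.
  have := bsig_le0 hM i; set b := bsig i; move: (_ + _) => q b0 qb.
  apply: le_trans (_ : r * b <= _); first by rewrite ler_wpM2l // (le_trans (ltW r0p)).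
  exact: ler_wnM2r.
have [-> -> ->] := typeB_blocks hM ti.
rewrite !mul0mx !addr0 !mxdot_col_mx -scalemxAr !mxdotZl !mxdotZr mxdot0r !addr0 mulrA -expr2.
have := bsig_le0 hM i; set b := bsig i; move: (mxdot _ _) => q b0 qb.
apply: le_trans (_ : r ^+ 2 * b <= _); first by rewrite ler_wpM2l // sqr_ge0.
by apply: ler_wnM2r => //; rewrite ler_pXn2r // nnegrE ltW // (lt_le_trans r0p).
Qed.

Lemma false_alarm_le t k r (s : saddle M t) eps : (1 <= t <= horizon M)%N -> 0 < eps ->
  is_saddle k r s -> SV t k r = ln (varkappa M eps) -> nuisance M x ->
  (P [set w | (detector k r s (obs w t) < alpha M)%R] <=
   (eps / (horizon M * nshapes M)%:R)%:E)%E.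
Proof.
move=> ht eps0 ss SVE hx.
have D0 : 0 < (horizon M * nshapes M)%:R :> R.
  by rewrite ltr0n muln_gt0 (horizon_gt0 hM) (nshapes_gt0 hM).
have mN : measurable_fun setT (fun w => - detector k r s (obs w t)).
  by apply: measurableT_comp => //; exact: measurable_detector.
apply: (@le_trans _ _ (P [set w | (- alpha M <= - detector k r s (obs w t))%R])).
  apply: le_measure.
  - exact/mem_set/measurable_lt/measurable_detector.
  - exact/mem_set/measurable_ge.
  by move=> w /= /ltW; rewrite lerN2.
apply: le_trans (markov_expR P _ mN) _; rewrite opprK.
apply: (@le_trans _ _ ((expR (alpha M))%:E * (expR (SV t k r))%:E)%E).
  by rewrite lee_wpmul2l ?lee_fin ?expR_ge0 // nuisance_mgf.
rewrite -EFinM lee_fin SVE lnK ?posrE ?divr_gt0 ?sqrtr_gt0 // /alpha -mulNr expR_ln_sqrt //.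
(* With D the number of detectors, both exp alpha and varkappa / eps equal D^(-1/2). *)
by rewrite /varkappa mulrCA -invfM -expr2 sqr_sqrtr // ltW.
Qed.

Lemma missed_signal_le t k r (s : saddle M t) eps : (1 <= t <= horizon M)%N -> 0 < eps ->
  is_saddle k r s -> SV t k r = ln (varkappa M eps) -> calZ k r (Zmx x) ->
  (P [set w | (alpha M <= detector k r s (obs w t))%R] <= eps%:E)%E.
Proof.
move=> ht eps0 ss SVE hx.
have D0 : 0 < (horizon M * nshapes M)%:R :> R.
  by rewrite ltr0n muln_gt0 (horizon_gt0 hM) (nshapes_gt0 hM).
apply: le_trans (markov_expR P _ (measurable_detector k r s)) _.
apply: (@le_trans _ _ ((expR (- alpha M))%:E * (expR (SV t k r))%:E)%E).
  by rewrite lee_wpmul2l ?lee_fin ?expR_ge0 // signal_mgf.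
rewrite -EFinM lee_fin SVE lnK ?posrE ?divr_gt0 ?sqrtr_gt0 // expRN /alpha -mulNr.
by rewrite expR_ln_sqrt // invrK /varkappa mulrC divfK // gt_eqF // sqrtr_gt0.
Qed.

Context (rho : nat -> 'I_(nshapes M) -> \bar R).
Context (sp : forall t, 'I_(nshapes M) -> saddle M t).

(** Finiteness is part of the event, so a pair with infinite magnitude contributes the empty set. *)
Definition alarm_event t k : set Om :=
  [set w | (rho t k < +oo)%E /\ detector k (fine (rho t k)) (sp t k) (obs w t) < alpha M].

Lemma measurable_alarm_event t k : measurable (alarm_event t k).
Proof.
have [h|h] := boolP (rho t k < +oo)%E; last first.
  rewrite (_ : alarm_event t k = set0) //; apply/seteqP; split=> w //= [h' _].
  by rewrite h' in h.
rewrite (_ : alarm_event t k =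
  [set w | detector k (fine (rho t k)) (sp t k) (obs w t) < alpha M]).
  exact/measurable_lt/measurable_detector.
by apply/seteqP; split=> w /= [].
Qed.

(** A finite union, for measurability and the union bound. Times start at 1 and ordinals at 0, hence
    the successor. *)
Lemma alarm_events t : (t <= horizon M)%N ->
  [set w | exists s, (s <= t)%N /\ procedure rho sp (obs w) = Some s] =
  \big[setU/set0]_(i : 'I_t * 'I_(nshapes M)) alarm_event i.1.+1 i.2.
Proof.
move=> td; rewrite -bigcup_seq; apply/seteqP; split=> w /=.
  move=> /(procedure_le _ _ _ td)[s [/andP[s1 st] [k sk]]].
  have st' : (s.-1 < t)%N by rewrite prednK.
  by exists (Ordinal st', k); rewrite /= ?mem_index_enum // /alarm_event prednK.
move=> [[i k] _ /= ik]; apply/(procedure_le _ _ _ td); exists i.+1.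
by split; [rewrite ltn_ord|exists k].
Qed.

End Procedure.

Theorem proposition4p3 (R : realType) (M : model R) (hM : model_ok M)
  (eps : R) (heps : 0 < eps < 2^-1)
  (rho : nat -> 'I_(nshapes M) -> \bar R) (hrho : magnitudes_ok eps rho)
  (sp : forall t, 'I_(nshapes M) -> saddle M t) (hsp : saddles_ok rho sp)
  (dsp : measure_display) (Om : measurableType dsp) (P : probability Om R)
  (Theta : 'M[R]_(nu M (horizon M))) (hTheta : Ucov M Theta)
  (xi : Om -> 'cV[R]_(nu M (horizon M))) (hxi : centered_gaussian P xi Theta)
  (x : 'cV[R]_(dimx M)) (hx : admissible M x) :
  (nuisance M x ->
   (P [set w | exists s, procedure rho sp (observations x (xi w)) = Some s]
    <= eps%:E)%E) /\
  (forall (k : 'I_(nshapes M)) (r : R) (t : nat),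
   0 < r -> signal k r x -> (1 <= t <= horizon M)%N -> (rho t k <= r%:E)%E ->
   ((1 - eps)%:E
    <= P [set w | exists s, (s <= t)%N /\
                  procedure rho sp (observations x (xi w)) = Some s])%E).
Proof.
have /andP[eps0 _] := heps.
have rho_fin t k : (1 <= t <= horizon M)%N -> (rho t k < +oo)%E ->
    exists r : R, [/\ rho t k = r%:E, 0 < r, is_saddle k r (sp t k)
                    & SV t k r = ln (varkappa M eps)].
  move=> ht rk; have [hlt hle] := hrho t k ht.
  have [/hlt rkoo|/hle[r [rE /andP[r0 _] SVE]]] := ltP (ln (varkappa M eps)) (SV t k (rmax k)).
    by rewrite rkoo ltxx in rk.
  by exists r; split=> //; have := hsp t k ht rk; rewrite rE.
split=> [hn|k r t r0 xr ht rk].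
  have -> : [set w | exists s, procedure rho sp (observations x (xi w)) = Some s] =
    [set w | exists s, (s <= horizon M)%N /\ procedure rho sp (observations x (xi w)) = Some s].
    apply/seteqP; split=> w /= [s]; last by case=> _ ?; exists s.
    by move=> E; exists s; have [/andP[]] := procedure_Some E.
  rewrite alarm_events //; apply: le_trans.
    by apply: measure_bigsetU_le => i; exact: (measurable_alarm_event hxi).
  have D0 : (horizon M * nshapes M)%:R != 0 :> R.
    by rewrite pnatr_eq0 muln_eq0 negb_or -!lt0n (horizon_gt0 hM) (nshapes_gt0 hM).
  apply: (@le_trans _ _ (\sum_(i : 'I_(horizon M) * 'I_(nshapes M))
      (eps / (horizon M * nshapes M)%:R)%:E)%E).
    apply: lee_sum => -[i k] _ /=.
    have ht : (1 <= i.+1 <= horizon M)%N by rewrite ltn_ord.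
    have [fin|nfin] := boolP (rho i.+1 k < +oo)%E; last first.
      have -> : alarm_event xi x rho sp i.+1 k = set0.
        by apply/seteqP; split=> w //= [h]; rewrite h in nfin.
      by rewrite measure0 lee_fin divr_ge0 // ltW.
    have [r [rE _ ss SVE]] := rho_fin _ _ ht fin.
    have -> : alarm_event xi x rho sp i.+1 k = [set w |
        detector k r (sp i.+1 k) (observations x (xi w) i.+1) < alpha M].
      by apply/seteqP; split=> w; rewrite /alarm_event rE /= ?ltry // => -[].
    exact: (false_alarm_le hM hTheta hxi ht eps0 ss SVE hn).
  rewrite sumEFin lee_fin sumr_const card_prod !card_ord.
  by rewrite -[X in X <= _]mulr_natr divfK.
have rkoo : (rho t k < +oo)%E by apply: le_lt_trans rk _; exact: ltry.
have [r1 [rE r10 ss SVE]] := rho_fin _ _ ht rkoo.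
(* The detector is built for [r1], the value of [rho t k]; a signal of magnitude at least r is also
   one for [r1]. *)
have r1r : r1 <= r by move: rk; rewrite rE lee_fin.
have xZ : calZ k r1 (Zmx x) by apply: (calZ_signal hM hx _ xr); rewrite r10.
have mdet := measurable_detector hxi x k r1 (sp t k).
have := missed_signal_le hM hTheta hxi ht eps0 ss SVE xZ.
pose det w := detector k r1 (sp t k) (observations x (xi w) t).
have -> : [set w | (alpha M <= det w)%R] = ~` [set w | det w < alpha M].
  by apply/seteqP; split=> w /=; rewrite leNgt => /negP.
have mlt : measurable [set w | det w < alpha M] := measurable_lt _ mdet.
rewrite probability_setC // => miss.
have /andP[_ td] := ht.
apply: (@le_trans _ _ (P [set w | det w < alpha M])).
  rewrite EFinB; move: miss; rewrite !leeBlDr ?fin_num_measure // addeC //.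
apply: le_measure; first exact/mem_set.
  rewrite alarm_events //; apply/mem_set; apply: bigsetU_measurable => i _.
  exact: (measurable_alarm_event hxi).
(* An alarm of the single detector (t, k) already ensures termination by time t. *)
move=> w /= dw; apply/(procedure_le _ _ _ td); exists t.
by rewrite (proj1 (andP ht)) leqnn; split=> //; exists k; rewrite rE /= ltry.
Qed.
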